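(* For all $d\ge 2$ and $n\ge 1$, a $d$-permutation of size $n$ is a Baxter $d$-permutation if and only if it avoids every generalized vincular pattern in $A\cup B\cup C\cup D$, where $A=\mathrm{Sym}(2413;\{2\},\{2\})=\{(2413;\{2\},\{2\}),(3142;\{2\},\{2\})\}$, $B=\mathrm{Sym}((132,231);\{1\},\{1\},\emptyset)$, $C=\mathrm{Sym}((3412,1432);\{2\},\{2\},\emptyset)$, $D=\mathrm{Sym}((2143,1423);\{2\},\{2\},\emptyset)$. That is, $B_n^{d-1}=S_n^{d-1}(A,B,C,D)$.
   Context: A $d$-permutation of size $n$ is a tuple $(\sigma_1,\dots,\sigma_{d-1})$ of permutations of $[n]$, with diagram $P=\{(i,\sigma_1(i),\dots,\sigma_{d-1}(i)):i\in[n]\}\subset[n]^d$. For an increasing sequence $i_1<\dots<i_{d'}$ in $[d]$ the direct projection is the $d'$-permutation with diagram $\{(p_{i_1},\dots,p_{i_{d'}}):p\in P\}$. Slices: two points $p,q$ of a diagram are $k$-adjacent if their $k$-th coordinates differ by exactly one; the slice of such a pair is the closed box with opposite corners $p,q$, of type $k$ for each $k$ for which $p,q$ are $k$-adjacent. Its direction is the sign vector of $q-p$ where $p_1<q_1$. Two slices intersect if their intersection has nonempty interior. A $d'$-permutation is well-sliced if every slice intersects exactly one slice of each type $k\in[d']$ and any two intersecting slices have the same direction. A Baxter $d$-permutation is one all of whose direct projections (of every dimension $d'\le d$, including itself) are well-sliced; $B_n^{d-1}$ is their set. A generalized vincular pattern $(\boldsymbol\pi;X_1,\dots,X_{d'})$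 consists of a $d'$-permutation $\boldsymbol\pi$ of size $k$ and sets $X_r\subseteq[k-1]$; a pair $(\pi_1,\pi_2)$ denotes the $3$-permutation with those two permutations and a single permutation denotes a $2$-permutation. Points $p_1,\dots,p_k$ of the diagram of a $d'$-permutation form an occurrence if their standardization (same relative order in each coordinate, on $[k]^{d'}$) is the diagram of $\boldsymbol\pi$ and, for each $r$ and each $i\in X_r$, the $i$-th and $(i+1)$-th of these points in the order along axis $r$ are $r$-adjacent. A $d$-permutation contains the pattern if some direct projection of dimension $d'$ contains an occurrence; $S_n^{d-1}(\dots)$ is the set of $d$-permutations of size $n$ avoiding all listed patterns. Symmetries: for a $d'\times d'$ signed permutation matrix $s$ (entries in $\{-1,0,1\}$, one nonzero per row and column), with $s_{r',r}=\pm1$, the image of $(\boldsymbol\pi;X_1,\dots,X_{d'})$ is the pattern whose permutation has diagram the standardization of $\{sp:p\in P_{\boldsymbol\pi}\}$ and whose adjacency set on axis $r'$ is $X_r$ if $s_{r',r}=1$ and $\{k-i: i\in X_r\}$ if $s_{r',r}=-1$; $\mathrm{Sym}$ of a pattern is the set of its images under all $d'\times d'$ signed permutation matrices. *)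

(* Defs.v *)
From HB Require Import structures.
From mathcomp Require Import all_boot all_order all_fingroup all_algebra finmap.
From mathcomp Require Import all_classical reals topology normedtype.

Set Implicit Arguments.
Unset Strict Implicit.
Unset Printing Implicit Defensive.
Import Order.TTheory GRing.Theory Num.Theory.
Import numFieldNormedType.Exports.

Local Open Scope classical_set_scope.
Local Open Scope fset_scope.
Local Open Scope ring_scope.

Notation zpoint d := 'cV[int]_d.

Definition dperm (d n : nat) := (d.-1).-tuple {perm 'I_n}.

(* Coordinate 0 of the i-th point is given by the identity, coordinate r > 0   *)
(* by the r-th permutation of the tuple; values are shifted from 'I_n to [n].  *)
Definition dpoint (d n : nat) (sigma : dperm d n) (i : 'I_n) : zpoint d :=
  \col_(r < d) ((nth 1%g (1%g :: tval sigma) r) i).+1%:Z.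

Definition diagram (d n : nat) (sigma : dperm d n) : {fset zpoint d} :=
  [fset dpoint sigma i | i : 'I_n].

Definition increasing (d' d : nat) (f : 'I_d' -> 'I_d) : Prop :=
  forall i j : 'I_d', (i < j)%N -> (f i < f j)%N.

Definition direct_proj (d' d : nat) (f : 'I_d' -> 'I_d) (P : {fset zpoint d}) :
    {fset zpoint d'} :=
  [fset rowsub f p | p in P].

Definition adjacent (d : nat) (k : 'I_d) (p q : zpoint d) : Prop :=
  `|p k 0 - q k 0| = 1.

(* A slice is represented by its pair of corners (p, q), ordered by p_1 < q_1. *)
(* In a diagram distinct points differ in every coordinate, so such pairs      *)
(* correspond bijectively to the boxes.                                        *)
Definition slice_of_type (d : nat) (P : {fset zpoint d.+1}) (k : 'I_d.+1)
    (s : zpoint d.+1 * zpoint d.+1) : Prop :=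
  [/\ s.1 \in P, s.2 \in P, s.1 ord0 0 < s.2 ord0 0 & adjacent k s.1 s.2].

Definition slice (d : nat) (P : {fset zpoint d.+1})
    (s : zpoint d.+1 * zpoint d.+1) : Prop :=
  exists k : 'I_d.+1, slice_of_type P k s.

Definition box (R : realType) (d : nat) (s : zpoint d * zpoint d) :
    set 'cV[R]_d :=
  [set x | forall r : 'I_d,
     (Num.min (s.1 r 0) (s.2 r 0))%:~R <= x r 0
       <= (Num.max (s.1 r 0) (s.2 r 0))%:~R].
Arguments box R {d} s.

Definition direction (d : nat) (s : zpoint d * zpoint d) : 'cV[int]_d :=
  map_mx Num.sg (s.2 - s.1).

Definition slices_intersect (R : realType) (d : nat)
    (s t : zpoint d * zpoint d) : Prop :=
  (box R s `&` box R t)° !=set0.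

(* A slice intersects itself and is counted among the slices it intersects.    *)
Definition well_sliced (R : realType) (d : nat) (P : {fset zpoint d.+1}) :
    Prop :=
  (forall s, slice P s -> forall k : 'I_d.+1,
     exists! t, slice_of_type P k t /\ slices_intersect R s t) /\
  (forall s t, slice P s -> slice P t -> slices_intersect R s t ->
     direction s = direction t).

Definition baxter (R : realType) (d n : nat) (sigma : dperm d n) : Prop :=
  forall (d' : nat) (f : 'I_d'.+1 -> 'I_d), increasing f ->
    well_sliced R (direct_proj f (diagram sigma)).

(* The 1-based rank of p among the points of P along axis r. *)
Definition axis_rank (d : nat) (P : {fset zpoint d}) (r : 'I_d) (p : zpoint d) :
    nat :=
  #|` [fset q in P | q r 0 <= p r 0]|.

Definition standardize (d : nat) (P : {fset zpoint d}) : {fset zpoint d} :=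
  [fset \col_(r < d) (axis_rank P r p)%:Z | p in P].

(* j : 'I_k.-1 encodes the element j + 1 of [k - 1]. *)
Record vincular (d k : nat) := Vincular {
  vperm : dperm d k;
  vadj : d.-tuple {set 'I_k.-1}
}.

Definition occurrence (d k : nat) (pi : vincular d k) (P O : {fset zpoint d}) :
    Prop :=
  [/\ O `<=` P, #|` O| = k, standardize O = diagram (vperm pi) &
      forall (r : 'I_d) (j : 'I_k.-1), j \in tnth (vadj pi) r ->
        forall p q, p \in O -> q \in O ->
          axis_rank O r p = j.+1 -> axis_rank O r q = j.+2 ->
          adjacent r p q].

Definition contains (d n d' k : nat) (sigma : dperm d n)
    (pi : vincular d' k) : Prop :=
  exists f : 'I_d' -> 'I_d, increasing f /\
    exists O, occurrence pi (direct_proj f (diagram sigma)) O.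

Definition avoids (d n d' k : nat) (sigma : dperm d n)
    (F : set (vincular d' k)) : Prop :=
  forall pi, F pi -> ~ contains sigma pi.

Definition signed_perm_mx (d : nat) (s : 'M[int]_d) : Prop :=
  [/\ forall i j, s i j \in [:: -1; 0; 1],
      forall i, #|[pred j | s i j != 0]| = 1%N &
      forall j, #|[pred i | s i j != 0]| = 1%N].

(* On 'I_k.-1, rev_ord encodes the reflection i |-> k - i of [k - 1]. *)
Definition sym_image (d k : nat) (s : 'M[int]_d) (pi pi' : vincular d k) :
    Prop :=
  diagram (vperm pi') = standardize [fset s *m p | p in diagram (vperm pi)] /\
  forall r' r : 'I_d,
    (s r' r = 1 -> tnth (vadj pi') r' = tnth (vadj pi) r) /\
    (s r' r = -1 ->
       tnth (vadj pi') r' = [set rev_ord j | j in tnth (vadj pi) r]%SET).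

Definition sym_class (d k : nat) (pi : vincular d k) : set (vincular d k) :=
  [set pi' | exists s : 'M[int]_d, signed_perm_mx s /\ sym_image s pi pi'].

Local Open Scope nat_scope.

Lemma word_lt (k : nat) (w : seq nat) (hw : perm_eq w (iota 1 k)) (i : 'I_k) :
  (nth 0 w i).-1 < k.
Proof.
have : nth 0 w i \in iota 1 k.
  by rewrite -(perm_mem hw) mem_nth // (perm_size hw) size_iota.
by rewrite mem_iota add1n => /andP[]; case: (nth _ _ _).
Qed.

Definition word_fun (k : nat) (w : seq nat) (hw : perm_eq w (iota 1 k))
    (i : 'I_k) : 'I_k := Ordinal (word_lt hw i).

Lemma word_fun_inj (k : nat) (w : seq nat) (hw : perm_eq w (iota 1 k)) :
  injective (word_fun hw).
Proof.
have sw : size w = k by rewrite (perm_size hw) size_iota.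
have w_gt0 (i : 'I_k) : 0 < nth 0 w i.
  have : nth 0 w i \in iota 1 k by rewrite -(perm_mem hw) mem_nth // sw.
  by rewrite mem_iota => /andP[].
move=> i j /(congr1 (fun x => (val x).+1)) /=; rewrite !prednK // => /eqP.
rewrite nth_uniq ?sw // ?(perm_uniq hw) ?iota_uniq // => /eqP.
exact: val_inj.
Qed.

(* The permutation of [k] with one-line notation w. *)
Definition word_perm (k : nat) (w : seq nat) (hw : perm_eq w (iota 1 k)) :
    {perm 'I_k} := perm (@word_fun_inj k w hw).

Definition adjset (k : nat) (X : seq nat) : {set 'I_k.-1} :=
  [set j : 'I_k.-1 | j.+1 \in X]%SET.

Definition pattern_2413 : vincular 2 4 :=
  @Vincular 2 4 [tuple word_perm (isT : perm_eq [:: 2; 4; 1; 3] (iota 1 4))]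
           [tuple adjset 4 [:: 2]; adjset 4 [:: 2]].

Definition pattern_3142 : vincular 2 4 :=
  @Vincular 2 4 [tuple word_perm (isT : perm_eq [:: 3; 1; 4; 2] (iota 1 4))]
           [tuple adjset 4 [:: 2]; adjset 4 [:: 2]].

Definition pattern_132_231 : vincular 3 3 :=
  @Vincular 3 3 [tuple word_perm (isT : perm_eq [:: 1; 3; 2] (iota 1 3));
                  word_perm (isT : perm_eq [:: 2; 3; 1] (iota 1 3))]
           [tuple adjset 3 [:: 1]; adjset 3 [:: 1]; adjset 3 [::]].

Definition pattern_3412_1432 : vincular 3 4 :=
  @Vincular 3 4 [tuple word_perm (isT : perm_eq [:: 3; 4; 1; 2] (iota 1 4));
                  word_perm (isT : perm_eq [:: 1; 4; 3; 2] (iota 1 4))]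
           [tuple adjset 4 [:: 2]; adjset 4 [:: 2]; adjset 4 [::]].

Definition pattern_2143_1423 : vincular 3 4 :=
  @Vincular 3 4 [tuple word_perm (isT : perm_eq [:: 2; 1; 4; 3] (iota 1 4));
                  word_perm (isT : perm_eq [:: 1; 4; 2; 3] (iota 1 4))]
           [tuple adjset 4 [:: 2]; adjset 4 [:: 2]; adjset 4 [::]].

Definition patterns_A := sym_class pattern_2413.
Definition patterns_B := sym_class pattern_132_231.
Definition patterns_C := sym_class pattern_3412_1432.
Definition patterns_D := sym_class pattern_2143_1423.

(* Main.v *)
(** Replace the coordinates by signed axes, so that every symmetry becomes a
    choice of axes [X], [Y], [Z].  A Baxter permutation is one in which every
    crossing of an [X]-slice (a, b) with a [Y]-slice (c, e) in the plane (X, Y)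
    has the same direction and persists, with the same direction, along every
    third axis [Z].  Existence of a crossing is an intermediate value argument;
    avoiding A gives its uniqueness and rules out crossings of opposite
    direction.  If the two slices share a point, avoiding B settles [Z].  For
    four distinct points the bad orders along [Z] are: opposite directions and
    disjoint (C), opposite and interleaved (D), opposite and nested (this forces
    an occurrence of A in (Y, Z) or (X, Z)), and same direction but disjoint.
    The last one corresponds to no pattern of the list: from such a separated
    crossing of the slice (a, b) one finds another one whose [X]-slice lies
    strictly to the left, which is impossible by finiteness. *)

Require Import Defs.
From HB Require Import structures.
From mathcomp Require Import all_boot all_order all_fingroup all_algebra finmap.
From mathcomp Require Import all_classical reals topology normedtype.
From mathcomp Require Import zify lra.

Set Implicit Arguments.
Unset Strict Implicit.
Unset Printing Implicit Defensive.
Import Order.TTheory GRing.Theory Num.Theory.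
Import numFieldNormedType.Exports.

Local Open Scope classical_set_scope.
Local Open Scope fset_scope.
Local Open Scope ring_scope.

(** Of the 24 orders, the hypotheses exclude twelve in which the two pairs point opposite ways: four
    disjoint, four interleaved, four nested. Left are eight overlapping orders and four disjoint
    ones, with both pairs pointing the same way. *)
Lemma order4_cases (a b c e : int) :
  a <> b -> c <> e -> c <> b -> a <> e -> a <> c -> b <> e ->
  ~~ [&& c < e, e < b & b < a] -> ~~ [&& a < b, b < e & e < c] ->
  ~~ [&& e < c, c < a & a < b] -> ~~ [&& b < a, a < c & c < e] ->
  ~~ [&& c < b, b < e & e < a] -> ~~ [&& a < e, e < b & b < c] ->
  ~~ [&& e < a, a < c & c < b] -> ~~ [&& b < c, c < a & a < e] ->
  ~~ [&& c < b, b < a & a < e] -> ~~ [&& e < a, a < b & b < c] ->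
  ~~ [&& a < e, e < c & c < b] -> ~~ [&& b < c, c < e & e < a] ->
  ([&& a < b, c < e, a < e & c < b] \/ [&& b < a, e < c, e < a & b < c]) \/
  ([&& a < b, b < c & c < e] \/ [&& c < e, e < a & a < b]) \/
  ([&& b < a, c < b & e < c] \/ [&& e < c, a < e & b < a]).
Proof.
case: (ltgtP a b) => [?|?|E /(_ E) //] _; case: (ltgtP c e) => [?|?|E /(_ E) //] _;
case: (ltgtP c b) => [?|?|E /(_ E) //] _; case: (ltgtP a e) => [?|?|E /(_ E) //] _;
case: (ltgtP a c) => [?|?|E /(_ E) //] _; case: (ltgtP b e) => [?|?|E /(_ E) //] _;
by rewrite /=; lia.
Qed.

(** * Abstract axes, crossings and patterns *)

Section SignedAxes.
Variables (T : Type) (A : (T -> int) -> Prop).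

Definition opp_axis (X : T -> int) : T -> int := fun t => - X t.

(** What is used of the coordinates and their negatives. The absence of gaps in [axis_fill] replaces
    continuity in the intermediate value arguments. *)
Record axis_system : Prop := AxisSystem {
  axis_inj : forall X, A X -> injective X;
  axis_opp : forall X, A X -> A (opp_axis X);
  axis_fill : forall X p q m, A X -> X p <= m <= X q -> exists r, X r = m }.

(* The consecutive pair (a, b) along X meets the consecutive pair (c, e)       *)
(* along Y, and they have the same direction in the plane (X, Y).              *)
Definition crossing (X Y : T -> int) (a b c e : T) : Prop :=
  [/\ X b = X a + 1, Y e = Y c + 1, X c <= X a /\ X b <= X e
    & Y a <= Y c /\ Y e <= Y b].

(** Over injective axes the weak inequalities are strict, and the points in the order [e], [a], [b],
    [c] form 3142 with both adjacencies. *)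
Definition back_crossing (X Y : T -> int) (a b c e : T) : Prop :=
  [/\ X b = X a + 1, Y e = Y c + 1, X e <= X a /\ X b <= X c
    & Y a <= Y c /\ Y e <= Y b].

Definition concordant (Z : T -> int) (a b c e : T) : Prop :=
  [&& Z a < Z b, Z c < Z e, Z a < Z e & Z c < Z b].

Definition crossings_agree : Prop :=
  (forall X Y a b c e, A X -> A Y -> ~ back_crossing X Y a b c e) /\
  (forall X Y Z a b c e, A X -> A Y -> A Z -> crossing X Y a b c e ->
     concordant Z a b c e \/ concordant (opp_axis Z) a b c e).

(* Occurrences of the patterns of the theorem up to symmetry, [a b c e] being  *)
(* the points of the pattern named as in [crossing].                           *)
Definition occ_A : Prop := exists X Y a b c e,
  [/\ A X, A Y & back_crossing X Y a b c e].

Definition occ_B : Prop := exists X Y Z a b e,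
  [/\ A X, A Y & A Z] /\
  [/\ X b = X a + 1, Y e = Y a + 1, X b < X e, Y e < Y b & Z e < Z a < Z b].

Definition crossing4 (X Y : T -> int) (a b c e : T) : Prop :=
  [/\ X b = X a + 1, Y e = Y c + 1, X c < X a /\ X b < X e
    & Y a < Y c /\ Y e < Y b].

Definition occ_C : Prop := exists X Y Z a b c e,
  [/\ A X, A Y & A Z] /\
  crossing4 X Y a b c e /\ [&& Z c < Z e, Z e < Z b & Z b < Z a].

Definition occ_D : Prop := exists X Y Z a b c e,
  [/\ A X, A Y & A Z] /\
  crossing4 X Y a b c e /\ [&& Z c < Z b, Z b < Z e & Z e < Z a].

Hypothesis Asys : axis_system.

(** Discrete intermediate value theorem: go down from [q] along [X], one unit at a time, until a
    point satisfies [P]. *)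
Lemma last_exit (X : T -> int) (P : pred T) p q :
    A X -> X p < X q -> P p -> ~~ P q ->
  exists u v, [/\ X v = X u + 1, X p <= X u, X v <= X q, P u
    & forall r, X v <= X r <= X q -> ~~ P r].
Proof.
move=> AX ltpq Pp.
have [n] := ubnP `|X q - X p|%N; elim: n q ltpq => // n IH q ltpq len_n nPq.
have [r Xr] : exists r, X r = X q - 1 by apply: (axis_fill (p := p) (q := q) Asys AX); lia.
have eqq s : X q <= X s <= X q -> s = q.
  by move=> h; apply: (axis_inj Asys AX); lia.
have [Pr|nPr] := boolP (P r).
  exists r, q; split => //; [lia|lia|].
  by move=> s /eqq ->.
have neq_pr : X p <> X r.
  by move=> /(axis_inj Asys AX) epr; rewrite -epr Pp in nPr.
have [|||u [v [h1 h2 h3 h4 h5]]] := IH r => //; try lia.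
exists u, v; split=> //; first lia.
move=> s hs; have [|hs'] := boolP (X s <= X r).
  by move=> hs'; apply: h5; lia.
by rewrite (eqq s) //; lia.
Qed.

(** * Crossings in a plane without back crossings *)

Section NoBack.
Hypothesis no_back : forall X Y a b c e, A X -> A Y -> ~ back_crossing X Y a b c e.

(** From [p] to [q] the value of [Y] must step down past the gap between [Y c] and [Y e]. These are
    consecutive, so the last such step makes a back crossing with (c, e). *)
Lemma no_return X Y c e p q : A X -> A Y -> Y e = Y c + 1 ->
  X c <= X p -> X p < X q -> X q <= X e -> Y e <= Y p -> Y q <= Y c -> False.
Proof.
move=> AX AY hY h1 h2 h3 h4 h5.
have [|u [v [k1 k2 k3 k4 k5]]] := @last_exit X (fun t => Y e <= Y t) p q AX h2 h4.
  by lia.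
have := k5 v; rewrite k3 lexx => /(_ isT) k6.
by apply: (@no_back Y X c e u v AY AX); split; lia.
Qed.

(** From a point above [Y c] on this stretch, going on to [a] would be a return. In [crossing_right]
    the return runs from [b] to the offending point. *)
Lemma crossing_left X Y a b c e r : A X -> A Y -> crossing X Y a b c e ->
  X c <= X r -> X r <= X a -> Y r <= Y c.
Proof.
move=> AX AY [h1 h2 h3 h4] k1 k2; rewrite leNgt; apply/negP => k3.
have : X r <> X a by move=> /(axis_inj Asys AX) E; subst r; lia.
by move=> k4; apply: (@no_return X Y c e r a AX AY); lia.
Qed.

Lemma crossing_right X Y a b c e r : A X -> A Y -> crossing X Y a b c e ->
  X b <= X r -> X r <= X e -> Y e <= Y r.
Proof.
move=> AX AY [h1 h2 h3 h4] k1 k2; rewrite leNgt; apply/negP => k3.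
have : X b <> X r by move=> /(axis_inj Asys AX) E; subst r; lia.
by move=> k4; apply: (@no_return X Y c e b r AX AY); lia.
Qed.

Lemma crossing_sym X Y a b c e : crossing X Y a b c e -> crossing Y X c e a b.
Proof. by case=> *; split. Qed.

(** If one [Y]-slice lay above the other, going along [Y] from the end of the lower to the start of
    the upper would be a return across (a, b). *)
Lemma crossing_unique X Y a b c e c' e' : A X -> A Y ->
  crossing X Y a b c e -> crossing X Y a b c' e' -> c = c' /\ e = e'.
Proof.
move=> AX AY [h1 h2 h3 h4] [k1 k2 k3 k4].
have n1 : ~ Y c < Y c'.
  move=> lt_cc'; have : Y e <> Y c' by move=> /(axis_inj Asys AY) E; subst e; lia.
  by move=> ?; apply: (@no_return Y X a b e c' AY AX); lia.
have n2 : ~ Y c' < Y c.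
  move=> lt_cc'; have : Y e' <> Y c by move=> /(axis_inj Asys AY) E; subst e'; lia.
  by move=> ?; apply: (@no_return Y X a b e' c AY AX); lia.
by split; apply: (axis_inj Asys AY); lia.
Qed.

(** Going along [Y] from [a] to [b], the last passage of [X] across the gap between [X a] and [X b]
    is the wanted slice. *)
Lemma crossing_exists X Y a b : A X -> A Y -> X b = X a + 1 -> Y a < Y b ->
  exists c e, crossing X Y a b c e.
Proof.
move=> AX AY h1 h2.
have [||u [v [k1 k2 k3 k4 k5]]] := @last_exit Y (fun t => X t <= X a) a b AY h2.
- by lia.
- by lia.
have := k5 v; rewrite k3 lexx => /(_ isT) k6.
by exists u, v; split; lia.
Qed.

End NoBack.

(** * Descent on separated crossings *)

Definition separated (Z : T -> int) (a b c e : T) : Prop :=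
  [&& Z a < Z b, Z b < Z c & Z c < Z e].

Definition concordant_or_separated (Z : T -> int) (a b c e : T) : Prop :=
  [\/ concordant Z a b c e, separated Z a b c e | separated Z c e a b].

Section Descent.
Hypothesis no_back : forall X Y a b c e, A X -> A Y -> ~ back_crossing X Y a b c e.
Hypothesis weak_agree : forall X Y Z a b c e, A X -> A Y -> A Z ->
  crossing X Y a b c e ->
  concordant_or_separated Z a b c e \/ concordant_or_separated (opp_axis Z) a b c e.

(** Only [X] and [a] are parameters: the descent keeps [X], exchanges the roles of the other two
    axes and lowers [X a]. *)
Definition separated_crossing_at (X : T -> int) (a : T) : Prop :=
  exists Y Z b c e, [/\ A Y, A Z, crossing X Y a b c e
    & separated Z a b c e \/ separated Z c e a b].

Lemma separated_or_agree X Y Z a b c e : A X -> A Y -> A Z ->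
  crossing X Y a b c e ->
  [\/ concordant Z a b c e, concordant (opp_axis Z) a b c e
    | separated_crossing_at X a].
Proof.
move=> AX AY AZ cr; have AZ' := axis_opp Asys AZ.
have [[]|[]] := weak_agree AX AY AZ cr; first by constructor 1.
- by constructor 3; exists Y, Z, b, c, e; split => //; left.
- by constructor 3; exists Y, Z, b, c, e; split => //; right.
- by constructor 2.
- by constructor 3; exists Y, (opp_axis Z), b, c, e; split => //; left.
- by constructor 3; exists Y, (opp_axis Z), b, c, e; split => //; right.
Qed.

(* The new crossing consists of the last [X]-slice (u, v) between [c] and [a]  *)
(* that goes from above [b] to below [b] along [Z], and of the [Z]-slice it    *)
(* crosses; were these two concordant along [Y], they would create a return.   *)
Lemma descent_below X Y Z a b c e : A X -> A Y -> A Z ->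
  crossing X Y a b c e -> separated Z a b c e ->
  exists2 a', X a' < X a & separated_crossing_at X a'.
Proof.
move=> AX AY AZ cr /and3P[z1 z2 z3].
have Aopp := axis_opp Asys.
have le_left := crossing_left no_back AX AY cr.
have ge_right := crossing_right no_back AX AY cr.
have [x1 y1 x2 y2] := cr.
have neq_ca : X c <> X a by move=> /(axis_inj Asys AX) E; subst c; lia.
have neq_be : X b <> X e by move=> /(axis_inj Asys AX) E; subst b; lia.
have [|||u [v [u1 u2 u3 u4 u5]]] := @last_exit X (fun t => Z b < Z t) c a AX; try lia.
have zv : Z v <= Z b by have := u5 v; lia.
(* Negating [Z] makes the falling slice (u, v) rise. Along [Z], [g] is one above [f], and [zbf] and
   [zgc] place both between [b] and [c]. *)
have [|g [f cr']] := @crossing_exists X (opp_axis Z) u v AX (Aopp _ AZ) u1.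
  by rewrite /opp_axis; lia.
have [_ fg xfg zfg] := cr'; rewrite /opp_axis in fg zfg.
have zlow := crossing_left no_back (Aopp _ AZ) AX (crossing_sym cr').
have zhigh := crossing_right no_back (Aopp _ AZ) AX (crossing_sym cr').
rewrite /opp_axis in zlow zhigh.
have zbf : Z b <= Z f.
  by rewrite leNgt; apply/negP => lt_fb; have := zlow b; lia.
have zgc : Z g <= Z c.
  rewrite leNgt; apply/negP => lt_cg.
  by have := zhigh c; lia.
(* [f] is to the right of [a], since from [v] to [a] no level exceeds [Z b]. Up to [e], [ge_right]
   applies; if [f] were beyond [e], passing from [b] to [e] would be a return across (g, f). *)
have yf : Y e <= Y f.
  have [xfa|xfa] := lerP (X f) (X a).
    have : Z f <> Z b by move=> /(axis_inj Asys AZ) E; subst f; lia.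
    by have := u5 f; lia.
  have [xfe|xfe] := lerP (X f) (X e); first by apply: ge_right; lia.
  exfalso.
  have zz : opp_axis Z f = opp_axis Z g + 1 by rewrite /opp_axis; lia.
  by apply: (no_return no_back (p := b) (q := e) AX (Aopp _ AZ) zz);
     rewrite /opp_axis; lia.
have yu := le_left u; have yv := le_left v.
(* Along [Y], [u] and [v] are not above [c], and [f] is not below [e]. So the slices cannot both
   fall and overlap; if both rise and overlap, passing from [v] to [e] along [Y] is a return. *)
have [/and4P[g1 g2 g3 g4]|/and4P[]|sep] := separated_or_agree AX (Aopp _ AZ) AY cr'.
- exfalso; apply: (no_return no_back (Y := opp_axis Z) (p := v) (q := e) (c := g) (e := f) AY (Aopp _ AZ));
    rewrite /opp_axis; lia.
- by rewrite /opp_axis; lia.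
- by exists u => //; lia.
Qed.

(* As above, with the level of [b] replaced by that of the [Z]-slice (k, l)    *)
(* crossed by (c, e).                                                          *)
Lemma descent_above X Y Z a b c e : A X -> A Y -> A Z ->
  crossing X Y a b c e -> separated Z c e a b ->
  exists2 a', X a' < X a & separated_crossing_at X a'.
Proof.
move=> AX AY AZ cr /and3P[z1 z2 z3].
have le_left := crossing_left no_back AX AY cr.
have ge_right := crossing_right no_back AX AY cr.
have y_left := crossing_left no_back AY AX (crossing_sym cr).
have [x1 y1 x2 y2] := cr.
have neq_ca : X c <> X a by move=> /(axis_inj Asys AX) E; subst c; lia.
(* The slice (k, l) is a good threshold because points with [Z] between [Z l] and [Z e] have [Y] at
   least [Y e] ([zl_high]); this later bounds [g]. *)
have [k [l crk]] := crossing_exists AY AZ y1 z1.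
have [_ kl ykl zkl] := crk.
have zk_low := crossing_left no_back AZ AY (crossing_sym crk).
have zl_high := crossing_right no_back AZ AY (crossing_sym crk).
(* Were [k] beyond [a] along [X], it would be below [a] along [Y], and passing from [a] to [c] along
   [Y] would be a return across (k, l). *)
have xk : X k <= X a.
  rewrite leNgt; apply/negP => xk.
  have yka : ~ Y a <= Y k by have := y_left k; lia.
  have neq_ac : Y a <> Y c by move=> /(axis_inj Asys AY) E; subst c; lia.
  by apply: (no_return no_back (p := a) (q := c) AY AZ kl); lia.
have [|||u [v [u1 u2 u3 u4 u5]]] := @last_exit X (fun t => Z t <= Z k) c a AX; try lia.
have zv : Z l <= Z v by have := u5 v; lia.
have xku : X k <= X u.
  by rewrite leNgt; apply/negP => xku; have := u5 k; lia.
have [|f [g cr']] := @crossing_exists X Z u v AX AZ u1; first lia.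
have [_ fg xfg zfg] := cr'.
have zlow := crossing_left no_back AZ AX (crossing_sym cr').
have zhigh := crossing_right no_back AZ AX (crossing_sym cr').
have zkf : Z k <= Z f.
  by rewrite leNgt; apply/negP => lt; have := zhigh k; lia.
have zge : Z g <= Z e.
  by rewrite leNgt; apply/negP => lt; have := zlow e; lia.
have yg : Y e <= Y g by apply: zl_high; lia.
have yu := le_left u; have yv := le_left v.
(* As in the previous descent, with the return now from [v] to [c]. *)
have [/and4P[g1 g2 g3 g4]|/and4P[]|sep] := separated_or_agree AX AZ AY cr'.
- exfalso; have neq_vc : Y v <> Y c.
    by move=> /(axis_inj Asys AY) E; subst v; lia.
  by apply: (no_return no_back (Y := Z) (p := v) (q := c) (c := f) (e := g) AY AZ); lia.
- by rewrite /opp_axis; lia.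
- by exists u => //; lia.
Qed.

Lemma not_separated X a : A X -> (exists m : int, forall t, m <= X t) ->
  ~ separated_crossing_at X a.
Proof.
move=> AX [m lem].
have [n] := ubnP `|X a - m|%N; elim: n a => // n IH a len_n sep.
have [Y [Z [b [c [e [AY AZ cr sepZ]]]]]] := sep.
have [a' lt_a' sep'] : exists2 a', X a' < X a & separated_crossing_at X a'.
  by case: sepZ; [apply: descent_below cr | apply: descent_above cr].
apply: IH sep'; have := lem a'; lia.
Qed.

End Descent.

(** * Pattern avoidance and agreement of crossings *)

Section AvoidancePatterns.
Hypothesis lower_bounded : forall X, A X -> exists m : int, forall t, m <= X t.
Hypothesis no_A : ~ occ_A.
Hypothesis no_B : ~ occ_B.
Hypothesis no_C : ~ occ_C.
Hypothesis no_D : ~ occ_D.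

Lemma no_back_of_no_A X Y a b c e : A X -> A Y -> ~ back_crossing X Y a b c e.
Proof.
by move=> AX AY bc; apply: no_A; exists X, Y, a, b, c, e.
Qed.

Let no_ret := no_return no_back_of_no_A.

(** The cases are by common points of the two slices: with both they coincide, with one B applies,
    with none C and D, and A for the nested orders. *)
Lemma weak_agree_of_avoids X Y Z a b c e : A X -> A Y -> A Z ->
  crossing X Y a b c e ->
  concordant_or_separated Z a b c e \/ concordant_or_separated (opp_axis Z) a b c e.
Proof.
move=> AX AY AZ [x1 y1 x2 y2]; have Aopp := axis_opp Asys.
have Zne s t : s <> t -> Z s <> Z t by move=> h /(axis_inj Asys AZ).
have neq_ab : Z a <> Z b by apply: Zne => E; subst b; lia.
have neq_ce : Z c <> Z e by apply: Zne => E; subst e; lia.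
have neq_cb : Z c <> Z b by apply: Zne => E; subst b; lia.
have neq_ae : Z a <> Z e by apply: Zne => E; subst e; lia.
have decide : concordant Z a b c e \/ concordant (opp_axis Z) a b c e ->
    concordant_or_separated Z a b c e \/ concordant_or_separated (opp_axis Z) a b c e.
  by case=> h; [left|right]; constructor.
have [Exca|nXca] := eqVneq (X c) (X a).
  have E := axis_inj Asys AX Exca; subst c; apply: decide.
  have [Exbe|nXbe] := eqVneq (X b) (X e).
    have E := axis_inj Asys AX Exbe; subst e.
    by rewrite /concordant /opp_axis; lia.
  have nYeb : Y e <> Y b by move=> /(axis_inj Asys AY) E; subst e; rewrite eqxx in nXbe.
  have n1 : ~ (Z e < Z a < Z b).
    move=> h; apply: no_B; exists X, Y, Z, a, b, e; do 2!split=> //; lia.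
  have n2 : ~ (Z b < Z a < Z e).
    move=> h; apply: no_B; exists X, Y, (opp_axis Z), a, b, e; do 2!split=> //;
      rewrite ?/opp_axis; try lia; exact: Aopp.
  by rewrite /concordant /opp_axis; lia.
(* Negating [X] and [Y] turns the common upper end [b] into a common lower end. *)
have [Exbe|nXbe] := eqVneq (X b) (X e).
  have E := axis_inj Asys AX Exbe; subst e; apply: decide.
  have nYac : Y a <> Y c by move=> /(axis_inj Asys AY) E; subst c; rewrite eqxx in nXca.
  have n1 : ~ (Z c < Z b < Z a).
    move=> h; apply: no_B; exists (opp_axis X), (opp_axis Y), Z, b, a, c.
    by rewrite /opp_axis; do 2!split=> //; try exact: Aopp; lia.
  have n2 : ~ (Z a < Z b < Z c).
    move=> h; apply: no_B; exists (opp_axis X), (opp_axis Y), (opp_axis Z), b, a, c.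
    by rewrite /opp_axis; do 2!split=> //; try exact: Aopp; lia.
  by rewrite /concordant /opp_axis; lia.
have nYac : Y a <> Y c by move=> /(axis_inj Asys AY) E; subst c; rewrite eqxx in nXca.
have nYeb : Y e <> Y b by move=> /(axis_inj Asys AY) E; subst e; rewrite eqxx in nXbe.
have neq_ac : Z a <> Z c by apply: Zne => E; subst c; rewrite eqxx in nXca.
have neq_be : Z b <> Z e by apply: Zne => E; subst e; rewrite eqxx in nXbe.
have cr4 : crossing4 X Y a b c e by split; lia.
(* Negating [X] and [Y] reverses both slices, and negating [Z] reverses the order; so C and D each
   forbid four orders. *)
have cr4' : crossing4 (opp_axis X) (opp_axis Y) b a e c.
  by rewrite /crossing4 /opp_axis; split; lia.
have nC1 : ~~ [&& Z c < Z e, Z e < Z b & Z b < Z a].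
  by apply/negP => h; apply: no_C; exists X, Y, Z, a, b, c, e.
have nC2 : ~~ [&& Z a < Z b, Z b < Z e & Z e < Z c].
  apply/negP => h; apply: no_C; exists X, Y, (opp_axis Z), a, b, c, e; do 2!split=> //.
  - exact: Aopp.
  - by rewrite /opp_axis; lia.
have nC3 : ~~ [&& Z e < Z c, Z c < Z a & Z a < Z b].
  apply/negP => h; apply: no_C; exists (opp_axis X), (opp_axis Y), Z, b, a, e, c; do 2!split=> //;
    exact: Aopp.
have nC4 : ~~ [&& Z b < Z a, Z a < Z c & Z c < Z e].
  apply/negP => h; apply: no_C; exists (opp_axis X), (opp_axis Y), (opp_axis Z), b, a, e, c.
  do 2!split=> //; try exact: Aopp.
  by rewrite /opp_axis; lia.
have nD1 : ~~ [&& Z c < Z b, Z b < Z e & Z e < Z a].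
  by apply/negP => h; apply: no_D; exists X, Y, Z, a, b, c, e.
have nD2 : ~~ [&& Z a < Z e, Z e < Z b & Z b < Z c].
  apply/negP => h; apply: no_D; exists X, Y, (opp_axis Z), a, b, c, e; do 2!split=> //.
  - exact: Aopp.
  - by rewrite /opp_axis; lia.
have nD3 : ~~ [&& Z e < Z a, Z a < Z c & Z c < Z b].
  apply/negP => h; apply: no_D; exists (opp_axis X), (opp_axis Y), Z, b, a, e, c; do 2!split=> //;
    exact: Aopp.
have nD4 : ~~ [&& Z b < Z c, Z c < Z a & Z a < Z e].
  apply/negP => h; apply: no_D; exists (opp_axis X), (opp_axis Y), (opp_axis Z), b, a, e, c.
  do 2!split=> //; try exact: Aopp.
  by rewrite /opp_axis; lia.
(* Nested opposite orders: along [Z], the inner slice is a return across the outer one. *)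
have nN1 : ~~ [&& Z c < Z b, Z b < Z a & Z a < Z e].
  by apply/negP => h; apply: (no_ret (p := b) (q := a) AZ AY y1); lia.
have nN2 : ~~ [&& Z e < Z a, Z a < Z b & Z b < Z c].
  apply/negP => h; have y1' : opp_axis Y c = opp_axis Y e + 1 by rewrite /opp_axis; lia.
  by apply: (no_ret (p := a) (q := b) AZ (Aopp _ AY) y1'); rewrite /opp_axis; lia.
have nN3 : ~~ [&& Z a < Z e, Z e < Z c & Z c < Z b].
  by apply/negP => h; apply: (no_ret (p := e) (q := c) AZ AX x1); lia.
have nN4 : ~~ [&& Z b < Z c, Z c < Z e & Z e < Z a].
  apply/negP => h; have x1' : opp_axis X a = opp_axis X b + 1 by rewrite /opp_axis; lia.
  by apply: (no_ret (p := c) (q := e) AZ (Aopp _ AX) x1'); rewrite /opp_axis; lia.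
have [h|[h|h]] : (concordant Z a b c e \/ concordant (opp_axis Z) a b c e) \/
    (separated Z a b c e \/ separated Z c e a b) \/
    (separated (opp_axis Z) a b c e \/ separated (opp_axis Z) c e a b).
- by rewrite /concordant /separated /opp_axis !ltrN2; apply: order4_cases.
- exact: decide.
- by left; case: h; [constructor 2|constructor 3].
- by right; case: h; [constructor 2|constructor 3].
Qed.

Lemma avoidance_crossings_agree : crossings_agree.
Proof.
split; first exact: no_back_of_no_A.
move=> X Y Z a b c e AX AY AZ cr.
have nsep := not_separated no_back_of_no_A weak_agree_of_avoids AX (lower_bounded AX).
by have [h|h|/nsep //] := separated_or_agree weak_agree_of_avoids AX AY AZ cr;
  [left|right].
Qed.

End AvoidancePatterns.

(** An occurrence of B is a crossing with [c = a]. The orders that B, C and D prescribe along [Z]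
    are concordant for neither sign. *)
Lemma crossings_agree_avoidance : crossings_agree ->
  [/\ ~ occ_A, ~ occ_B, ~ occ_C & ~ occ_D].
Proof.
move=> [nb ag]; split.
- by move=> [X [Y [a [b [c [e [AX AY bc]]]]]]]; apply: nb bc.
- move=> [X [Y [Z [a [b [e [[AX AY AZ] [h1 h2 h3 h4 h5]]]]]]]].
  have := ag X Y Z a b a e AX AY AZ; case; rewrite /concordant /opp_axis; [by split; lia|lia|lia].
- move=> [X [Y [Z [a [b [c [e [[AX AY AZ] [[h1 h2 h3 h4] h5]]]]]]]]].
  have := ag X Y Z a b c e AX AY AZ; case; rewrite /concordant /opp_axis; [by split; lia|lia|lia].
- move=> [X [Y [Z [a [b [c [e [[AX AY AZ] [[h1 h2 h3 h4] h5]]]]]]]]].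
  have := ag X Y Z a b c e AX AY AZ; case; rewrite /concordant /opp_axis; [by split; lia|lia|lia].
Qed.

End SignedAxes.

(** * Intersecting boxes as overlapping intervals *)

Definition strict_overlap (x y z w : int) : bool :=
  Num.max (Num.min x y) (Num.min z w) < Num.min (Num.max x y) (Num.max z w).

Lemma slices_intersectP (R : realType) (d : nat) (s t : zpoint d * zpoint d) :
  slices_intersect R s t <->
  forall r, strict_overlap (s.1 r 0) (s.2 r 0) (t.1 r 0) (t.2 r 0).
Proof.
split=> [[x]|ov].
  rewrite /interior /= => /nbhs_ballP[e /= e_gt0 sub_box] r.
  have e2_gt0 : 0 < e / 2 by rewrite divr_gt0.
  have lt_e2 : `|e / 2| < e by rewrite gtr0_norm // ltr_pdivrMr // mulr2n mulrDr mulr1 ltrDl.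
  (* Moving an interior point by half the radius both ways in all coordinates makes the inequalities
     between the bounds strict. *)
  have mem_shift (y : R) : `|y| < e -> (box R s `&` box R t)%classic (x + const_mx y).
    move=> ye; apply: sub_box; split=> // i j; rewrite /ball /= !mxE.
    by rewrite opprD addNKr normrN.
  have [/(_ r) /= + /(_ r) /=] := mem_shift _ lt_e2.
  have /mem_shift[/(_ r) /= + /(_ r) /=] : `|- (e / 2)| < e by rewrite normrN.
  rewrite !mxE => /andP[s1 _] /andP[t1 _] /andP[_ s2] /andP[_ t2].
  have lt_shift : x r 0 - e / 2 < x r 0 + e / 2 by rewrite ltrD2l gtrN.
  have lt_int (m k : int) : m%:~R <= x r 0 - e / 2 -> x r 0 + e / 2 <= k%:~R -> m < k.
    by move=> h1 h2; rewrite -(ltr_int R); apply: le_lt_trans h1 (lt_le_trans lt_shift h2).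
  have := lt_int _ _ s1 t2; have := lt_int _ _ t1 s2.
  have := lt_int _ _ s1 s2; have := lt_int _ _ t1 t2.
  by rewrite /strict_overlap; lia.
pose lo r : int := Num.max (Num.min (s.1 r 0) (s.2 r 0)) (Num.min (t.1 r 0) (t.2 r 0)).
pose hi r : int := Num.min (Num.max (s.1 r 0) (s.2 r 0)) (Num.max (t.1 r 0) (t.2 r 0)).
exists (\col_r (((lo r)%:~R + (hi r)%:~R) / 2 : R)).
(* The bounds are integers, so the common box has sides at least 1 and contains the ball of radius
   1/2 around its centre. *)
rewrite /interior /=; apply/nbhs_ballP; exists 2^-1 => /=; first by rewrite invr_gt0.
move=> y xy.
have mid r : (lo r)%:~R <= y r 0 <= (hi r)%:~R.
  have [_ /(_ r 0)] := xy; rewrite /ball /= !mxE ltr_distl => /andP[y1 y2].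
  have : (lo r)%:~R + 1 <= (hi r)%:~R :> R.
    rewrite -[1]/(1%:~R) -intrD ler_int; have := ov r.
    by rewrite /strict_overlap /lo /hi; lia.
  by lra.
split=> r /=; have /andP[h1 h2] := mid r; apply/andP; split.
- by apply: le_trans h1; rewrite ler_int /lo; lia.
- by apply: (le_trans h2); rewrite ler_int /hi; lia.
- by apply: le_trans h1; rewrite ler_int /lo; lia.
- by apply: (le_trans h2); rewrite ler_int /hi; lia.
Qed.

(** With integer ends, an interval that overlaps one of length 1 contains it. The order of [c] and
    [e] along [X] separates the two outcomes. *)
Lemma overlap_crossing (T : Type) (X Y : T -> int) a b c e :
  X b = X a + 1 -> Y e = Y c + 1 -> Y a < Y b ->
  strict_overlap (X a) (X b) (X c) (X e) ->
  strict_overlap (Y a) (Y b) (Y c) (Y e) ->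
  crossing X Y a b c e \/ back_crossing X Y a b c e.
Proof.
rewrite /strict_overlap => hX hY lt_ab ovX ovY.
have [lt_ce|le_ec] := ltrP (X c) (X e); [left|right]; split; lia.
Qed.

Lemma slice_of_slice_type d (P : {fset zpoint d.+1}) k s :
  slice_of_type P k s -> slice P s.
Proof. by move=> ?; exists k. Qed.

(** * Signed coordinates and projected slices *)

Section Diagram.
Variables (d n : nat) (sigma : dperm d n).

Definition axis_perm (r : 'I_d) : {perm 'I_n} := nth 1%g (1%g :: tval sigma) r.

Definition coord (r : 'I_d) (i : 'I_n) : int := (axis_perm r i).+1%:Z.

Lemma coord_inj r : injective (coord r).
Proof. by move=> i j; rewrite /coord => -[] /val_inj /perm_inj. Qed.

Definition signed_coord (r : 'I_d) (s : bool) (i : 'I_n) : int :=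
  if s then - coord r i else coord r i.

Definition signed_axis (X : 'I_n -> int) : Prop :=
  exists r s, X = signed_coord r s.

Lemma signed_coord_axis r s : signed_axis (signed_coord r s).
Proof. by exists r, s. Qed.

Lemma signed_axis_system : axis_system signed_axis.
Proof.
split.
- by move=> _ [r [[] ->]] i j; [move=> /oppr_inj|]; apply: coord_inj.
- move=> _ [r [s ->]]; exists r, (~~ s); apply/funext => i.
  by rewrite /opp_axis /signed_coord; case: s; rewrite //= opprK.
- have fill r p q m : coord r p <= m <= coord r q -> exists i, coord r i = m.
    rewrite /coord; case: m => [[|m]|m]; try lia.
    set t := axis_perm r => /andP[_ hq].
    have lt_mn : (m < n)%N by have := ltn_ord (t q); lia.
    by exists ((t^-1)%g (Ordinal lt_mn)); rewrite permKV.
  move=> _ p q m [r [[] ->]]; rewrite /signed_coord; last exact: fill.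
  move=> h; have [|i E] := @fill r q p (- m); first lia.
  by exists i; rewrite E opprK.
Qed.

Lemma signed_axis_lower_bounded X : signed_axis X ->
  exists m : int, forall i, m <= X i.
Proof.
move=> [r [s ->]]; exists (- n%:Z) => i; rewrite /signed_coord /coord.
by have := ltn_ord (axis_perm r i); case: s; lia.
Qed.

Section Projection.
Variables (d' : nat) (f : 'I_d'.+1 -> 'I_d).

Definition proj_point (i : 'I_n) : zpoint d'.+1 := rowsub f (dpoint sigma i).

Lemma proj_pointE i k : proj_point i k 0 = coord (f k) i.
Proof. by rewrite !mxE. Qed.

Let P := direct_proj f (diagram sigma).

Lemma mem_direct_proj p : reflect (exists i, p = proj_point i) (p \in P).
Proof.
apply: (iffP (imfsetP _ _ _ _)) => [[q /imfsetP[i _ ->] ->]|[i ->]]; first by exists i.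
by exists (dpoint sigma i) => //; apply/imfsetP; exists i.
Qed.

Lemma slice_of_typeP k s : slice_of_type P k s <->
  exists i j, [/\ s = (proj_point i, proj_point j),
    coord (f ord0) i < coord (f ord0) j & `|coord (f k) i - coord (f k) j| = 1].
Proof.
case: s => p q; split=> [[/= /mem_direct_proj[i ->] /mem_direct_proj[j ->]]|].
  by rewrite /adjacent !proj_pointE; exists i, j.
move=> [i [j [[-> ->] lt_ij adj]]]; split=> /=.
- by apply/mem_direct_proj; exists i.
- by apply/mem_direct_proj; exists j.
- by rewrite !proj_pointE.
- by rewrite /adjacent !proj_pointE.
Qed.

Lemma proj_slices_intersectP (R : realType) i j i' j' :
  slices_intersect R (proj_point i, proj_point j) (proj_point i', proj_point j') <->
  forall k, strict_overlap (coord (f k) i) (coord (f k) j) (coord (f k) i') (coord (f k) j').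
Proof.
by rewrite slices_intersectP; split=> h k; have := h k; rewrite /= !proj_pointE.
Qed.

Lemma eq_directionP i j i' j' :
  direction (proj_point i, proj_point j) = direction (proj_point i', proj_point j') <->
  forall k, Num.sg (coord (f k) j - coord (f k) i) = Num.sg (coord (f k) j' - coord (f k) i').
Proof.
split=> [E k|h].
  by have := congr1 (fun A : 'cV[int]_d'.+1 => A k 0) E; rewrite !mxE.
by apply/colP => k; have := h k; rewrite !mxE.
Qed.

(** Slices are stored in the order of the first axis, crossings orient them along their own axes;
    this restores the stored order. *)
Definition ordered_slice (i j : 'I_n) : zpoint d'.+1 * zpoint d'.+1 :=
  if coord (f ord0) i < coord (f ord0) j then (proj_point i, proj_point j)
  else (proj_point j, proj_point i).

Lemma ordered_slice_type k i j : `|coord (f k) i - coord (f k) j| = 1 ->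
  slice_of_type P k (ordered_slice i j).
Proof.
move=> adj; apply/slice_of_typeP; rewrite /ordered_slice.
have ne : coord (f ord0) i <> coord (f ord0) j.
  by move=> /coord_inj E; rewrite E subrr in adj.
by case: ifP => lt_ij; [exists i, j|exists j, i]; split=> //; lia.
Qed.

Lemma ordered_slices_intersectP (R : realType) i j i' j' :
  slices_intersect R (ordered_slice i j) (ordered_slice i' j') <->
  forall k, strict_overlap (coord (f k) i) (coord (f k) j) (coord (f k) i') (coord (f k) j').
Proof.
rewrite /ordered_slice; case: ifP => _; case: ifP => _;
  rewrite proj_slices_intersectP; split=> h k; have := h k; rewrite /strict_overlap; lia.
Qed.

(** Whether a slice goes the same way along two axes is unchanged when its ends are exchanged; the
    exclusive or thus compares directions whatever the stored order. *)
Lemma ordered_slice_direction i j i' j' : i <> j -> i' <> j' ->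
  direction (ordered_slice i j) = direction (ordered_slice i' j') ->
  forall k1 k2,
    (coord (f k1) i < coord (f k1) j) (+) (coord (f k2) i < coord (f k2) j) =
    (coord (f k1) i' < coord (f k1) j') (+) (coord (f k2) i' < coord (f k2) j').
Proof.
move=> neq neq' dir k1 k2.
have ne k : coord (f k) i <> coord (f k) j by move=> /coord_inj.
have ne' k : coord (f k) i' <> coord (f k) j' by move=> /coord_inj.
move: (ne k1) (ne k2) (ne' k1) (ne' k2) dir; rewrite /ordered_slice.
by case: ifP => _; case: ifP => _ + + + + /eq_directionP h;
  have := h k1; have := h k2; lia.
Qed.

(** With no axes besides [k1] and [k2], overlapping along these two is intersecting, so opposite
    directions are forbidden. *)
Lemma well_sliced_no_back (R : realType) k1 k2 s1 s2 a b c e :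
  (forall k, k = k1 \/ k = k2) -> well_sliced R P ->
  ~ back_crossing (signed_coord (f k1) s1) (signed_coord (f k2) s2) a b c e.
Proof.
move=> k12 [_ dirs] [h1 h2 h3 h4].
have sl1 : slice_of_type P k1 (ordered_slice a b).
  by apply: ordered_slice_type; move: h1; rewrite /signed_coord; case: ifP; lia.
have sl2 : slice_of_type P k2 (ordered_slice c e).
  by apply: ordered_slice_type; move: h2; rewrite /signed_coord; case: ifP; lia.
have meet : slices_intersect R (ordered_slice a b) (ordered_slice c e).
  apply/ordered_slices_intersectP => k; case: (k12 k) => ->.
    by move: h1 h3; rewrite /signed_coord /strict_overlap; case: ifP; lia.
  by move: h2 h4; rewrite /signed_coord /strict_overlap; case: ifP; lia.
have neq_ab : a <> b by move=> E; subst b; lia.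
have neq_ce : c <> e by move=> E; subst e; lia.
have dir_eq := dirs _ _ (slice_of_slice_type sl1) (slice_of_slice_type sl2) meet.
have := ordered_slice_direction neq_ab neq_ce dir_eq k1 k2.
by move: h1 h2 h3 h4; rewrite /signed_coord; case: ifP; case: ifP; lia.
Qed.

End Projection.

Lemma signed_overlap r s i j i' j' :
  strict_overlap (signed_coord r s i) (signed_coord r s j)
    (signed_coord r s i') (signed_coord r s j') =
  strict_overlap (coord r i) (coord r j) (coord r i') (coord r j').
Proof. by rewrite /signed_coord /strict_overlap; case: s => //; lia. Qed.

Lemma crossings_agree_coord X Y a b c e r : crossings_agree signed_axis ->
  signed_axis X -> signed_axis Y -> crossing X Y a b c e ->
  strict_overlap (coord r a) (coord r b) (coord r c) (coord r e) /\
  Num.sg (coord r b - coord r a) = Num.sg (coord r e - coord r c).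
Proof.
move=> [_ ag] AX AY cr.
have := ag X Y _ a b c e AX AY (signed_coord_axis r false) cr.
by rewrite /concordant /opp_axis /signed_coord /strict_overlap; lia.
Qed.

(** Signs are chosen so that a slice of type [k1] rises along both axes. The slices of type [k2]
    that it meets are then its crossings, for which existence and uniqueness are known. *)
Lemma crossings_agree_well_sliced (R : realType) (d' : nat) (f : 'I_d'.+1 -> 'I_d) :
  crossings_agree signed_axis -> well_sliced R (direct_proj f (diagram sigma)).
Proof.
move=> ag; have [nb _] := ag.
have oriented k i j : coord (f k) i != coord (f k) j ->
    exists s, signed_coord (f k) s i < signed_coord (f k) s j.
  by move=> ne; exists (coord (f k) j < coord (f k) i); rewrite /signed_coord; case: ifP; lia.
have neq k i j : coord (f ord0) i < coord (f ord0) j -> coord (f k) i != coord (f k) j.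
  by move=> lt_ij; apply/eqP => /coord_inj E; rewrite E ltxx in lt_ij.
have meet k1 k2 i j c e : coord (f ord0) i < coord (f ord0) j ->
    `|coord (f k1) i - coord (f k1) j| = 1 ->
    coord (f ord0) c < coord (f ord0) e ->
    `|coord (f k2) c - coord (f k2) e| = 1 ->
    (forall k, strict_overlap (coord (f k) i) (coord (f k) j) (coord (f k) c) (coord (f k) e)) ->
    forall s1 s2, signed_coord (f k1) s1 i < signed_coord (f k1) s1 j ->
      signed_coord (f k2) s2 i < signed_coord (f k2) s2 j ->
      crossing (signed_coord (f k1) s1) (signed_coord (f k2) s2) i j c e.
  move=> lt_ij adj1 lt_ce adj2 ov s1 s2 lt1 lt2.
  have ax k s := signed_coord_axis (f k) s.
  have ov1 := ov k1; have ov2 := ov k2.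
  rewrite -(signed_overlap (f k1) s1) in ov1; rewrite -(signed_overlap (f k2) s2) in ov2.
  have X1 : signed_coord (f k1) s1 j = signed_coord (f k1) s1 i + 1.
    by move: lt1 adj1; rewrite /signed_coord; case: s1 {ov1}; lia.
  have [Y1|Y1] : signed_coord (f k2) s2 e = signed_coord (f k2) s2 c + 1 \/
      signed_coord (f k2) s2 c = signed_coord (f k2) s2 e + 1.
  - by move: adj2; rewrite /signed_coord; case: s2 {ov2 lt2}; lia.
  - by have [//|/nb[]] := overlap_crossing X1 Y1 lt2 ov1 ov2.
  (* If (e, c) were the rising orientation, agreement along the first axis would put [e] before [c],
     against [lt_ce]. *)
  - have [cr|/nb[]//] : crossing (signed_coord (f k1) s1) (signed_coord (f k2) s2) i j e c \/
        back_crossing (signed_coord (f k1) s1) (signed_coord (f k2) s2) i j e c.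
      apply: overlap_crossing => //.
        by move: ov1; rewrite /strict_overlap; lia.
      by move: ov2; rewrite /strict_overlap; lia.
    by have [_] := crossings_agree_coord (f ord0) ag (ax _ _) (ax _ _) cr; lia.
have ax k s := signed_coord_axis (f k) s.
split=> [s [k1 /slice_of_typeP[i [j [-> lt_ij adj1]]]] k2|s t].
  have [s1 lt1] := oriented k1 _ _ (neq k1 _ _ lt_ij).
  have [s2 lt2] := oriented k2 _ _ (neq k2 _ _ lt_ij).
  have X1 : signed_coord (f k1) s1 j = signed_coord (f k1) s1 i + 1.
    by move: lt1 adj1; rewrite /signed_coord; case: s1; lia.
  have [c [e cr]] := crossing_exists signed_axis_system (ax _ _) (ax _ _) X1 lt2.
  have agr r := crossings_agree_coord r ag (ax _ _) (ax _ _) cr.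
  have lt_ce : coord (f ord0) c < coord (f ord0) e by have [_] := agr (f ord0); lia.
  exists (proj_point f c, proj_point f e); split.
    split; last by apply/proj_slices_intersectP => k; have [] := agr (f k).
    apply/slice_of_typeP; exists c, e; split=> //.
    by have [_ + _ _] := cr; rewrite /signed_coord; case: s2 {lt2 cr agr}; lia.
  move=> t [/slice_of_typeP[c' [e' [-> lt_ce' adj2]]] /proj_slices_intersectP ov].
  have cr' := meet _ _ _ _ _ _ lt_ij adj1 lt_ce' adj2 ov _ _ lt1 lt2.
  by have [-> ->] := crossing_unique signed_axis_system nb (ax _ _) (ax _ _) cr cr'.
move=> [k1 /slice_of_typeP[i [j [-> lt_ij adj1]]]].
move=> [k2 /slice_of_typeP[c [e [-> lt_ce adj2]]]] /proj_slices_intersectP ov.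
have [s1 lt1] := oriented k1 _ _ (neq k1 _ _ lt_ij).
have [s2 lt2] := oriented k2 _ _ (neq k2 _ _ lt_ij).
have cr := meet _ _ _ _ _ _ lt_ij adj1 lt_ce adj2 ov _ _ lt1 lt2.
apply/eq_directionP => k.
by have [] := crossings_agree_coord (f k) ag (ax _ _) (ax _ _) cr.
Qed.

End Diagram.

(** * The Baxter property and agreement of crossings *)

Lemma baxter_no_back (R : realType) (d n : nat) (sigma : dperm d n) :
  baxter R sigma -> forall X Y a b c e,
    signed_axis sigma X -> signed_axis sigma Y -> ~ back_crossing X Y a b c e.
Proof.
move=> bax _ _ a b c e [r1 [s1 ->]] [r2 [s2 ->]].
(* Two distinct axes in increasing order give a projection to the plane; equal axes are excluded by
   arithmetic. *)
pose pair (r r' : 'I_d) (k : 'I_2) := if k == ord0 then r else r'.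
have pair_incr (r r' : 'I_d) : (r < r')%N -> increasing (pair r r').
  by move=> lt_rr' [[|[|i]] ?] [[|[|j]] ?].
have I2 (k : 'I_2) : k = ord0 \/ k = ord_max.
  by case: k => -[|[|k]] ? //; [left|right]; apply: val_inj.
have [lt12|lt21|eq12] := ltngtP r1 r2.
- exact: (well_sliced_no_back (k1 := ord0) (k2 := ord_max) I2 (bax _ _ (pair_incr _ _ lt12))).
- apply: (well_sliced_no_back (k1 := ord_max) (k2 := ord0) _ (bax _ _ (pair_incr _ _ lt21))).
  by move=> k; case: (I2 k); [right|left].
- move/val_inj: eq12 => ->; case; rewrite /signed_coord.
  by case: ifP; case: ifP; lia.
Qed.

(** In the full diagram, (a, b) meets a slice of type [r2]. In the plane (X, Y) this is a crossing,
    hence it is (c, e) by uniqueness; intersection and equal direction then also hold along the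
    third axis. *)
Lemma baxter_crossings_agree (R : realType) (d n : nat) (sigma : dperm d.+1 n) :
  baxter R sigma -> crossings_agree (signed_axis sigma).
Proof.
move=> bax; have nb := baxter_no_back bax; split=> //.
move=> X Y _ a b c e AX AY [r3 [s3 ->]] cr.
have [r1 [s1 EX]] := AX; have [r2 [s2 EY]] := AY.
have [exu dirs] : well_sliced R (direct_proj id (diagram sigma)) by apply: bax.
have [h1 h2 h3 h4] := cr.
have sl1 : slice_of_type (direct_proj id (diagram sigma)) r1 (ordered_slice sigma id a b).
  by apply: ordered_slice_type; move: h1; rewrite EX /signed_coord; case: ifP; lia.
have [t [[sl2 meet] _]] := exu _ (slice_of_slice_type sl1) r2.
have [i [j [Et lt_ij adj]]] := (slice_of_typeP _ _ _ _).1 sl2.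
have oij : ordered_slice sigma id i j = t by rewrite /ordered_slice lt_ij.
have oji : ordered_slice sigma id j i = t by rewrite /ordered_slice ltNge (ltW lt_ij).
have [c' [e' [Et' Y1]]] : exists c' e', ordered_slice sigma id c' e' = t /\ Y e' = Y c' + 1.
  have [E|E] : Y j = Y i + 1 \/ Y i = Y j + 1.
    by move: adj; rewrite EY /signed_coord; case: ifP; lia.
  - by exists i, j.
  - by exists j, i.
rewrite -Et' in meet sl2.
have ov := (ordered_slices_intersectP _ _ _ _ _ _ _).1 meet.
have ovX := ov r1; have ovY := ov r2.
rewrite /= -(signed_overlap sigma r1 s1) -EX in ovX.
rewrite /= -(signed_overlap sigma r2 s2) -EY in ovY.
have lt_ab : Y a < Y b by lia.
have cr' : crossing X Y a b c' e' by have [//|/nb[]] := overlap_crossing h1 Y1 lt_ab ovX ovY.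
have [Ec Ee] := crossing_unique (signed_axis_system sigma) nb AX AY cr cr'.
rewrite -{}Ec -{}Ee {c' e' cr' Et' Y1 ovX ovY} in sl2 meet ov.
have neq_ab : a <> b by move=> E; subst b; lia.
have neq_ce : c <> e by move=> E; subst e; lia.
have dir_eq := dirs _ _ (slice_of_slice_type sl1) (slice_of_slice_type sl2) meet.
have := ordered_slice_direction neq_ab neq_ce dir_eq r1 r3; have := ov r3.
have n1 : coord sigma r3 a <> coord sigma r3 b by move=> /coord_inj.
have n2 : coord sigma r3 c <> coord sigma r3 e by move=> /coord_inj.
move: h1 h3; rewrite EX /signed_coord /concordant /opp_axis /strict_overlap /=.
by case: ifP; case: ifP; lia.
Qed.

Lemma baxterP (R : realType) (d n : nat) (sigma : dperm d.+1 n) :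
  baxter R sigma <-> crossings_agree (signed_axis sigma).
Proof.
split; first exact: baxter_crossings_agree.
by move=> ag d' f _; apply: crossings_agree_well_sliced.
Qed.

(** * Ranks and standardization *)

Lemma dpointE d n (sigma : dperm d n) i r : dpoint sigma i r 0 = coord sigma r i.
Proof. by rewrite mxE. Qed.

Lemma axis_perm0 d n (sigma : dperm d.+1 n) : axis_perm sigma ord0 = 1%g.
Proof. by []. Qed.

Lemma axis_perm_lift d n (sigma : dperm d.+1 n) (r : 'I_d) :
  axis_perm sigma (lift ord0 r) = tnth sigma r.
Proof. by rewrite /axis_perm /= (tnth_nth 1%g). Qed.

Lemma diagram_inj d n : injective (@diagram d.+1 n).
Proof.
move=> sigma tau E; apply: eq_from_tnth => r; apply/permP => i.
rewrite -!axis_perm_lift.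
have : dpoint sigma i \in diagram tau by rewrite -E; apply/imfsetP; exists i.
case/imfsetP => j _ Ej.
have Ecoord r' : coord sigma r' i = coord tau r' j.
  by rewrite -!dpointE Ej.
have Eij : i = j.
  by have [] := Ecoord ord0; rewrite !axis_perm0 !perm1 => /val_inj.
by have := Ecoord (lift ord0 r); rewrite -Eij => -[] /val_inj.
Qed.

Section FamilyRank.
Variables (d k : nat) (q : 'I_k -> zpoint d) (g : 'I_d -> {perm 'I_k}).
Hypothesis qg : forall r i j, (q i r 0 <= q j r 0) = (g r i <= g r j)%N.
Let Q : {fset zpoint d} := [fset q i | i : 'I_k].

(** [g r] maps the indices of the points counted onto the initial segment up to [g r i]; its values
    start at 0, ranks at 1. *)
Lemma axis_rank_family r i : axis_rank Q r (q i) = (g r i).+1.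
Proof.
have q_inj : injective q.
  move=> a b Eab; apply: (@perm_inj _ (g r)); apply: val_inj.
  by apply/eqP; rewrite eqn_leq -!qg Eab lexx.
rewrite /axis_rank.
have -> : [fset x in Q | x r 0 <= q i r 0] = [fset q j | j in [pred j | g r j <= g r i]%N].
  apply/fsetP => x; apply/imfsetP/imfsetP => /=.
    by move=> [y /andP[/imfsetP[j _ ->]]]; rewrite qg => le_ji ->; exists j.
  move=> [j le_ji ->]; exists (q j) => //; apply/andP; rewrite qg; split=> //.
  by apply/imfsetP; exists j.
rewrite card_imfset //= -cardE -(fintype.card_image (perm_inj (s := g r))) -sum1_card.
rewrite (eq_bigl (fun m : 'I_k => m < (g r i).+1)%N) => [|m].
  by rewrite -(big_ord_widen k (fun=> 1%N)) // sum1_card card_ord.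
apply/fintype.imageP/idP => [[j le_ji ->]//|le_m].
by exists ((g r)^-1 m)%g; rewrite ?permKV // unfold_in /= permKV.
Qed.

Lemma standardize_family :
  standardize Q = [fset \col_r (g r i).+1%:Z | i : 'I_k].
Proof.
have colE i : \col_r (axis_rank Q r (q i))%:Z = \col_r (g r i).+1%:Z.
  by apply/colP => r; rewrite !mxE axis_rank_family.
apply/fsetP => x; apply/imfsetP/imfsetP => /=.
  by move=> [y /imfsetP[i _ ->] ->]; exists i; rewrite ?colE.
by move=> [i _ ->]; exists (q i); rewrite ?colE //; apply/imfsetP; exists i.
Qed.

End FamilyRank.

Lemma axis_rank_lt d (P : {fset zpoint d}) r p q :
  (axis_rank P r p < axis_rank P r q)%N -> p r 0 < q r 0.
Proof.
apply: contraTT; rewrite -leNgt -leqNgt => le_qp.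
apply: fsubset_leq_card; apply/fsubsetP => x.
rewrite !inE /= => /andP[-> le_xq] /=.
exact: le_trans le_xq le_qp.
Qed.

(** * Symmetries of a pattern and containment up to symmetry *)

Definition signed_mx d (rho : 'I_d -> 'I_d) (eps : 'I_d -> bool) : 'M[int]_d :=
  \matrix_(i, j) if rho i == j then (-1) ^+ eps i else 0.

Lemma signed_mxE d (rho : 'I_d -> 'I_d) eps (p : zpoint d) r :
  (signed_mx rho eps *m p) r 0 = (-1) ^+ eps r * p (rho r) 0.
Proof.
rewrite mxE (bigD1 (rho r)) //= !mxE eqxx big1 ?addr0 // => j.
by rewrite mxE eq_sym => /negPf ->; rewrite mul0r.
Qed.

Lemma signed_perm_signed_mx d (rho : {perm 'I_d}) eps :
  signed_perm_mx (signed_mx rho eps).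
Proof.
have nz i j : (signed_mx rho eps i j != 0) = (rho i == j).
  by rewrite mxE; case: (rho i == j); rewrite ?eqxx // signr_eq0.
split=> [i j|i|j].
- by rewrite mxE; case: ifP => _; case: (eps i).
- by rewrite -(card1 (rho i)); apply: eq_card => j; rewrite !inE nz eq_sym.
- rewrite -(card1 (rho^-1 j)%g); apply: eq_card => i; rewrite !inE nz.
  by apply/eqP/eqP => [<-|->]; rewrite ?permK ?permKV.
Qed.

Lemma signed_perm_mxP d (s : 'M[int]_d) : signed_perm_mx s ->
  exists (rho : {perm 'I_d}) eps, s = signed_mx rho eps.
Proof.
move=> [s_val s_row s_col].
have /choice[rho rhoP] i : exists j, forall j', (s i j' != 0) = (j' == j).
  by have [j jP] := mem_card1 (s_row i); exists j => j'; have := jP j'.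
have rho_inj : injective rho.
  move=> i i' E; have [i0 i0P] := mem_card1 (s_col (rho i)).
  have := i0P i; have := i0P i'; rewrite !inE !rhoP E eqxx.
  by move=> /esym/eqP -> /esym/eqP ->.
exists (perm rho_inj), (fun i => s i (rho i) == -1); apply/matrixP => i j.
rewrite mxE permE; case: (eqVneq (rho i) j) => [<-|ne].
  have : s i (rho i) != 0 by rewrite rhoP.
  have := s_val i (rho i); rewrite !inE => /or3P[]/eqP -> //=.
by apply/eqP/negbNE; rewrite rhoP eq_sym.
Qed.

Section SymPattern.
Variables (d k : nat) (pi : vincular d.+1 k).

(* The perm tuple of the image pattern is normalised so that its first axis is *)
(* the identity: [sym_axis r i] is the rank along axis [r] of the image of the *)
(* [i]-th point of [pi].                                                       *)
Definition sym_axis (rho : 'I_d.+1 -> 'I_d.+1) (eps : 'I_d.+1 -> bool)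
    (r : 'I_d.+1) : {perm 'I_k} :=
  if eps r then (axis_perm (vperm pi) (rho r) * perm (@rev_ord_inj k))%g
  else axis_perm (vperm pi) (rho r).

Definition sym_pattern (rho : 'I_d.+1 -> 'I_d.+1) (eps : 'I_d.+1 -> bool) :
    vincular d.+1 k :=
  @Vincular d.+1 k
    [tuple ((sym_axis rho eps ord0)^-1 * sym_axis rho eps (lift ord0 r))%g | r < d]
    [tuple if eps r then [set rev_ord j | j in tnth (vadj pi) (rho r)]%SET
           else tnth (vadj pi) (rho r) | r < d.+1].

Variables (rho : {perm 'I_d.+1}) (eps : 'I_d.+1 -> bool).

Lemma sym_axisE r i : sym_axis rho eps r i =
  if eps r then rev_ord (axis_perm (vperm pi) (rho r) i)
  else axis_perm (vperm pi) (rho r) i.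
Proof. by rewrite /sym_axis; case: ifP => // _; rewrite permM permE. Qed.

Lemma axis_perm_sym_pattern r : axis_perm (vperm (sym_pattern rho eps)) r =
  ((sym_axis rho eps ord0)^-1 * sym_axis rho eps r)%g.
Proof.
case: (unliftP ord0 r) => [r'|] ->; last by rewrite axis_perm0 mulVg.
by rewrite axis_perm_lift tnth_mktuple.
Qed.

Lemma diagram_sym_pattern : diagram (vperm (sym_pattern rho eps)) =
  [fset \col_r (sym_axis rho eps r i).+1%:Z | i : 'I_k].
Proof.
have E i : dpoint (vperm (sym_pattern rho eps)) (sym_axis rho eps ord0 i) =
    \col_r (sym_axis rho eps r i).+1%:Z.
  apply/colP => r; rewrite dpointE /coord axis_perm_sym_pattern mxE.
  by rewrite permM permK.
apply/fsetP => x; apply/imfsetP/imfsetP => /= -[i _ ->].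
  exists ((sym_axis rho eps ord0)^-1 i)%g => //.
  by rewrite -E permKV.
by exists (sym_axis rho eps ord0 i); rewrite // E.
Qed.

Lemma sym_patternP : sym_image (signed_mx rho eps) pi (sym_pattern rho eps).
Proof.
split.
  rewrite diagram_sym_pattern.
  have -> : [fset signed_mx rho eps *m p | p in diagram (vperm pi)] =
      [fset signed_mx rho eps *m dpoint (vperm pi) i | i : 'I_k].
    apply/fsetP => x; apply/imfsetP/imfsetP => /=.
      by move=> [y /imfsetP[i _ ->] ->]; exists i.
    by move=> [i _ ->]; exists (dpoint (vperm pi) i) => //; apply/imfsetP; exists i.
  rewrite (@standardize_family _ _ _ (sym_axis rho eps)) // => r i j.
  rewrite !signed_mxE !dpointE /coord !sym_axisE; case: (eps r) => //=.
    set t := axis_perm _ _; have := ltn_ord (t i); have := ltn_ord (t j); lia.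
  by rewrite !mul1r; lia.
move=> r' r; rewrite mxE !tnth_mktuple.
by case: eqP => [<-|]; case: (eps r').
Qed.

(** A diagram determines its permutations, and each axis of the image gets its adjacency set from
    one axis of [pi]. Hence the class consists of the patterns [sym_pattern]. *)
Lemma sym_image_uniq s pi1 pi2 : signed_perm_mx s ->
  sym_image s pi pi1 -> sym_image s pi pi2 -> pi1 = pi2.
Proof.
move=> /signed_perm_mxP[rho' [eps' ->]] [E1 A1] [E2 A2].
case: pi1 pi2 E1 A1 E2 A2 => [v1 a1] [v2 a2] /= E1 A1 E2 A2.
rewrite -E2 in E1; rewrite (diagram_inj E1); congr Vincular.
apply: eq_from_tnth => r; have [P1 N1] := A1 r (rho' r); have [P2 N2] := A2 r (rho' r).
rewrite !mxE eqxx in P1 P2 N1 N2.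
case: (eps' r) P1 P2 N1 N2 => P1 P2 N1 N2; first by rewrite N1 ?N2.
by rewrite P1 ?P2.
Qed.

End SymPattern.

Lemma sym_classP d k (pi pi' : vincular d.+1 k) : sym_class pi pi' <->
  exists (rho : {perm 'I_d.+1}) eps, pi' = sym_pattern pi rho eps.
Proof.
split=> [[s [sP im]]|[rho [eps ->]]].
  have [rho [eps E]] := signed_perm_mxP sP; exists rho, eps.
  by apply: sym_image_uniq sP im _; rewrite E; apply: sym_patternP.
exists (signed_mx rho eps); split; first exact: signed_perm_signed_mx.
exact: sym_patternP.
Qed.

(* The symmetries of the pattern and the increasing choice of axes in          *)
(* [contains] are merged into one injective choice [h] of axes with signs.     *)
Definition embeds (d n d' k : nat) (sigma : dperm d n) (pi : vincular d' k) : Prop :=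
  exists (h : 'I_d' -> 'I_d) (eps : 'I_d' -> bool) (p : 'I_k -> 'I_n),
  [/\ injective h,
      forall r i j, (axis_perm (vperm pi) r i < axis_perm (vperm pi) r j)%N ->
        signed_coord sigma (h r) (eps r) (p i) < signed_coord sigma (h r) (eps r) (p j)
    & forall r (m : 'I_k.-1) i j, m \in tnth (vadj pi) r ->
        axis_perm (vperm pi) r i = m :> nat -> axis_perm (vperm pi) r j = m.+1 :> nat ->
        signed_coord sigma (h r) (eps r) (p j) =
        signed_coord sigma (h r) (eps r) (p i) + 1].

(** The vectors of ranks index the points of the occurrence by those of [pi], and the inverse of
    [rho] returns to the axes of [pi]. *)
Lemma contains_sym_embeds d n d' k (sigma : dperm d n) (pi : vincular d'.+1 k)
    (rho : {perm 'I_d'.+1}) eps :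
  contains sigma (sym_pattern pi rho eps) -> embeds sigma pi.
Proof.
move=> [f [f_incr [O [sOP cardO stO adjO]]]].
have f_inj : injective f.
  by move=> i j E; case: (ltngtP i j) => [/f_incr|/f_incr|/val_inj //]; rewrite E ltnn.
have /choice[p pP] i : exists j, proj_point sigma f j \in O /\
    forall r, axis_rank O r (proj_point sigma f j) = (sym_axis pi rho eps r i).+1.
  have : \col_r (sym_axis pi rho eps r i).+1%:Z \in standardize O.
    by rewrite stO diagram_sym_pattern; apply/imfsetP; exists i.
  case/imfsetP => o /= oO E.
  have /mem_direct_proj[j Ej] := fsubsetP sOP _ oO.
  rewrite Ej in oO E; exists j; split=> // r.
  by have := congr1 (fun A : zpoint _ => A r 0) E; rewrite !mxE => -[].
have p_lt r i j : (sym_axis pi rho eps r i < sym_axis pi rho eps r j)%N ->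
    coord sigma (f r) (p i) < coord sigma (f r) (p j).
  have [_ Ei] := pP i; have [_ Ej] := pP j.
  by rewrite -ltnS -Ei -Ej => /axis_rank_lt; rewrite !proj_pointE.
pose t r := axis_perm (vperm pi) r.
have lt_t r i j : (t (rho r) i < t (rho r) j)%N ->
    signed_coord sigma (f r) (eps r) (p i) < signed_coord sigma (f r) (eps r) (p j).
  move=> lt_ij; have := p_lt r i j; have := p_lt r j i; rewrite !sym_axisE -/t /signed_coord.
  case: (eps r) => /=; last by move=> _; apply.
  move=> h _; rewrite ltrN2; apply: h; have := ltn_ord (t (rho r) j); move: lt_ij.
  by rewrite /t /=; lia.
exists (fun r => f (rho^-1 r)%g), (fun r => eps (rho^-1 r)%g), p; split.
- by move=> r r' /f_inj /perm_inj.
- by move=> r i j; have := @lt_t (rho^-1 r)%g i j; rewrite permKV.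
move=> r m i j; rewrite -(permKV rho r); move: (rho^-1 r)%g => {}r; rewrite permK.
rewrite -/(t (rho r)) => m_adj ti tj.
have := lt_t r i j; rewrite ti tj ltnSn => /(_ isT).
have [Oi Ei] := pP i; have [Oj Ej] := pP j.
move: (Ei r) (Ej r); rewrite !sym_axisE -/t.
have := adjO r; rewrite tnth_mktuple /signed_coord.
have lt_tj := ltn_ord (t (rho r) j); have lt_m := ltn_ord m.
case: (eps r) => adj rki rkj lt_ij.
  (* On a negated axis [j] comes just below [i], at the reflected rank. *)
  have := adj (rev_ord m); rewrite mem_imset ?m_adj; last exact: rev_ord_inj.
  move=> /(_ isT _ _ Oj Oi); rewrite rki rkj /= ti tj /adjacent !proj_pointE.
  have -> : (k - m.+2).+1 = (k.-1 - m.+1).+1 by lia.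
  have -> : (k - m.+1).+1 = (k.-1 - m.+1).+2 by lia.
  by move=> /(_ erefl erefl); lia.
have := adj m m_adj _ _ Oi Oj; rewrite rki rkj ti tj /adjacent !proj_pointE.
by move=> /(_ erefl erefl); lia.
Qed.

(** Direct projections take axes in increasing order only; sorting those chosen by [h] leaves a
    permutation, which the symmetry absorbs. *)
Lemma increasing_reindex m d (h : 'I_m -> 'I_d) : injective h ->
  exists (f : 'I_m -> 'I_d) (rho : {perm 'I_m}),
    increasing f /\ forall r, f r = h (rho r).
Proof.
(* [nth] below needs a default axis, so [d = 0] is treated apart. *)
move=> h_inj; case: d h h_inj => [|d] h h_inj.
  exists h, 1%g; split=> [i|r]; last by rewrite perm1.
  by case: (h i).
pose s := sort (relpre val leq) (codom h).
have size_s : size s = m by rewrite size_sort size_codom card_ord.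
have s_sorted : sorted (relpre val ltn) s.
  rewrite -sorted_map ltn_sorted_uniq_leq sorted_map sort_sorted ?andbT; last first.
    by move=> x y; apply: leq_total.
  by rewrite (map_inj_uniq val_inj) sort_uniq; apply/injectiveP.
pose f (r : 'I_m) := nth ord0 s r.
have f_incr : increasing f.
  move=> i j lt_ij; apply: (sorted_ltn_nth _ ord0 s_sorted) => //.
  - by move=> x y z; apply: ltn_trans.
  - by rewrite inE size_s.
  - by rewrite inE size_s.
have f_inj : injective f.
  by move=> i j E; case: (ltngtP i j) => [/f_incr|/f_incr|/val_inj //]; rewrite E ltnn.
have /choice[rho rhoP] r : exists r', f r = h r'.
  have : f r \in s by rewrite mem_nth ?size_s.
  by rewrite mem_sort => /codomP.
have rho_inj : injective rho.
  by move=> i j E; apply: f_inj; rewrite !rhoP E.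
by exists f, (perm rho_inj); split=> // r; rewrite permE.
Qed.

Lemma embeds_contains_sym d n d' k (sigma : dperm d n) (pi : vincular d'.+1 k) :
  embeds sigma pi ->
  exists (rho : {perm 'I_d'.+1}) eps, contains sigma (sym_pattern pi rho eps).
Proof.
move=> [h [eps0 [p [h_inj p_lt p_adj]]]].
have [f [rho [f_incr fh]]] := increasing_reindex h_inj.
pose eps r := eps0 (rho r); exists rho, eps, f; split=> //.
pose t r := axis_perm (vperm pi) r.
pose q i := proj_point sigma f (p i).
have qg r i j : (q i r 0 <= q j r 0) = (sym_axis pi rho eps r i <= sym_axis pi rho eps r j)%N.
  rewrite !proj_pointE fh !sym_axisE -/(t (rho r)) /eps.
  have lt_ti := ltn_ord (t (rho r) i); have lt_tj := ltn_ord (t (rho r) j).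
  have := p_lt (rho r) i j; have := p_lt (rho r) j i; rewrite -/(t (rho r)) /signed_coord.
  have [lt_ij|lt_ji|/val_inj/perm_inj ->] := ltngtP (t (rho r) i) (t (rho r) j).
  - by move=> _ /(_ isT); case: (eps0 (rho r)) => /=; lia.
  - by move=> /(_ isT) + _; case: (eps0 (rho r)) => /=; lia.
  - by rewrite lexx leqnn.
have q_inj : injective q.
  move=> i j E; apply: (@perm_inj _ (sym_axis pi rho eps ord0)); apply: val_inj.
  by apply/eqP; rewrite eqn_leq -!qg E lexx.
exists [fset q i | i : 'I_k]; split.
- apply/fsubsetP => _ /imfsetP[i _ ->]; apply/mem_direct_proj; by exists (p i).
- by rewrite card_imfset //= -cardE card_ord.
- by rewrite (standardize_family qg) diagram_sym_pattern.
move=> r m; rewrite tnth_mktuple => m_adj _ _ /imfsetP[i _ ->] /imfsetP[j _ ->].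
rewrite !(axis_rank_family qg) => -[rki] -[rkj].
move: m_adj rki rkj; rewrite !sym_axisE /adjacent !proj_pointE fh -/(t (rho r)) /eps.
have lt_ti := ltn_ord (t (rho r) i); have lt_tj := ltn_ord (t (rho r) j).
have adj m' i' j' := p_adj (rho r) m' i' j'.
rewrite -/(t (rho r)) /signed_coord in adj.
case: (eps0 (rho r)) adj => adj.
  move=> /imsetP[m' m'_adj ->] /= rki rkj; have lt_m' := ltn_ord m'.
  by have := adj m' j i m'_adj; lia.
by move=> m_adj rki rkj; have := adj m i j m_adj rki rkj; lia.
Qed.

Lemma avoids_sym_classP d n d' k (sigma : dperm d n) (pi : vincular d'.+1 k) :
  avoids sigma (sym_class pi) <-> ~ embeds sigma pi.
Proof.
split=> [av /embeds_contains_sym[rho [eps]]|nemb pi' /sym_classP[rho [eps ->]]].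
  by apply: av; apply/sym_classP; exists rho, eps.
by move=> /contains_sym_embeds.
Qed.

(** * The four patterns as configurations of signed axes *)

Lemma axis_perm_2413 (r : 'I_2) (i : 'I_4) : axis_perm (vperm pattern_2413) r i =
  nth 0%N (nth [::] [:: [:: 0; 1; 2; 3]; [:: 1; 3; 0; 2]]%N r) i :> nat.
Proof.
by case: r => -[|[|r]] // ?; case: i => -[|[|[|[|i]]]] // ?;
  rewrite /axis_perm /= ?perm1 ?permE.
Qed.

Lemma axis_perm_132_231 (r i : 'I_3) : axis_perm (vperm pattern_132_231) r i =
  nth 0%N (nth [::] [:: [:: 0; 1; 2]; [:: 0; 2; 1]; [:: 1; 2; 0]]%N r) i :> nat.
Proof.
by case: r => -[|[|[|r]]] // ?; case: i => -[|[|[|i]]] // ?;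
  rewrite /axis_perm /= ?perm1 ?permE.
Qed.

Lemma axis_perm_3412_1432 (r : 'I_3) (i : 'I_4) :
  axis_perm (vperm pattern_3412_1432) r i =
  nth 0%N (nth [::] [:: [:: 0; 1; 2; 3]; [:: 2; 3; 0; 1]; [:: 0; 3; 2; 1]]%N r) i :> nat.
Proof.
by case: r => -[|[|[|r]]] // ?; case: i => -[|[|[|[|i]]]] // ?;
  rewrite /axis_perm /= ?perm1 ?permE.
Qed.

Lemma axis_perm_2143_1423 (r : 'I_3) (i : 'I_4) :
  axis_perm (vperm pattern_2143_1423) r i =
  nth 0%N (nth [::] [:: [:: 0; 1; 2; 3]; [:: 1; 0; 3; 2]; [:: 0; 3; 1; 2]]%N r) i :> nat.
Proof.
by case: r => -[|[|[|r]]] // ?; case: i => -[|[|[|[|i]]]] // ?;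
  rewrite /axis_perm /= ?perm1 ?permE.
Qed.

Lemma pair_inj (T : eqType) (x y : T) : x != y -> injective (fun r : 'I_2 => nth x [:: x; y] r).
Proof.
move=> xy i j /= /eqP; rewrite nth_uniq ?size_tuple //=; last by rewrite inE xy.
by move=> /eqP /val_inj.
Qed.

Lemma triple_inj (T : eqType) (x y z : T) : x != y -> x != z -> y != z ->
  injective (fun r : 'I_3 => nth x [:: x; y; z] r).
Proof.
move=> xy xz yz i j /= /eqP; rewrite nth_uniq ?size_tuple //=.
  by move=> /eqP /val_inj.
by rewrite !inE (negPf xy) (negPf xz) (negPf yz).
Qed.

Section Occurrences.
Variables (d n : nat) (sigma : dperm d n).

Lemma opp_signed_coord r s i :
  signed_coord sigma r (~~ s) i = - signed_coord sigma r s i.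
Proof. by rewrite /signed_coord; case: s => //=; rewrite opprK. Qed.

(** Words of numbers evaluate, so every instance of the order and adjacency conditions can be
    settled by computation. *)
Lemma embeds_wordsP d' k (pi : vincular d' k) (ws : seq (seq nat)) :
  (forall (r : 'I_d') (i : 'I_k), axis_perm (vperm pi) r i = nth 0%N (nth [::] ws r) i :> nat) ->
  embeds sigma pi <-> exists (h : 'I_d' -> 'I_d) (eps : 'I_d' -> bool) (p : 'I_k -> 'I_n),
  [/\ injective h,
      forall (r : 'I_d') (i j : 'I_k), (nth 0%N (nth [::] ws r) i < nth 0%N (nth [::] ws r) j)%N ->
        signed_coord sigma (h r) (eps r) (p i) < signed_coord sigma (h r) (eps r) (p j)
    & forall (r : 'I_d') (m : 'I_k.-1) (i j : 'I_k), m \in tnth (vadj pi) r ->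
        nth 0%N (nth [::] ws r) i = m -> nth 0%N (nth [::] ws r) j = m.+1 ->
        signed_coord sigma (h r) (eps r) (p j) =
        signed_coord sigma (h r) (eps r) (p i) + 1].
Proof.
move=> wE; split=> -[h [eps [p [h_inj p_lt p_adj]]]]; exists h, eps, p; split=> //.
- by move=> r i j; rewrite -!wE; apply: p_lt.
- by move=> r m i j m_adj; rewrite -!wE; apply: p_adj.
- by move=> r i j; rewrite !wE; apply: p_lt.
- by move=> r m i j m_adj; rewrite !wE; apply: p_adj.
Qed.

(** The middle step of 2413, from 4 to 1, is the slice (a, b). It falls, so the second axis is
    negated; the values 3 and 2 give [c] and [e]. *)
Lemma embeds_2413P : embeds sigma pattern_2413 <-> occ_A (signed_axis sigma).
Proof.
apply: (iff_trans (embeds_wordsP axis_perm_2413)); split.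
  move=> [h [eps [p [_ lt adj]]]].
  pose p0 := @Ordinal 4 0 isT; pose p1 := @Ordinal 4 1 isT.
  pose p2 := @Ordinal 4 2 isT; pose p3 := @Ordinal 4 3 isT.
  pose x := @Ordinal 2 0 isT; pose y := @Ordinal 2 1 isT.
  exists (signed_coord sigma (h x) (eps x)), (signed_coord sigma (h y) (~~ eps y)).
  exists (p p1), (p p2), (p p3), (p p0).
  split; try exact: signed_coord_axis.
  have X01 := lt x p0 p1 isT; have X23 := lt x p2 p3 isT.
  have Y20 := lt y p2 p0 isT; have Y31 := lt y p3 p1 isT.
  have X12 := adj x (@Ordinal 3 1 isT) p1 p2; have Y03 := adj y (@Ordinal 3 1 isT) p0 p3.
  rewrite inE in X12; rewrite inE in Y03.
  have {}X12 := X12 isT erefl erefl; have {}Y03 := Y03 isT erefl erefl.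
  by rewrite /back_crossing !opp_signed_coord; split; lia.
move=> [_ [_ [a [b [c [e [[r1 [s1 ->]] [r2 [s2 ->]] bc]]]]]]].
have ne12 : r1 != r2.
  apply/eqP => E; subst r2; move: bc; rewrite /back_crossing /signed_coord.
  by case: s1; case: s2 => /= -[]; lia.
have sc_inj r s : injective (signed_coord sigma r s).
  exact: (axis_inj (signed_axis_system sigma) (signed_coord_axis sigma r s)).
have nXea : signed_coord sigma r1 s1 e <> signed_coord sigma r1 s1 a.
  by move=> /sc_inj E; subst e; case: bc; lia.
have nXbc : signed_coord sigma r1 s1 b <> signed_coord sigma r1 s1 c.
  by move=> /sc_inj E; subst b; case: bc; lia.
have nYac : signed_coord sigma r2 s2 a <> signed_coord sigma r2 s2 c.
  by move=> /sc_inj E; subst a; case: bc; lia.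
have nYeb : signed_coord sigma r2 s2 e <> signed_coord sigma r2 s2 b.
  by move=> /sc_inj E; subst e; case: bc; lia.
exists (fun r : 'I_2 => nth r1 [:: r1; r2] r), (fun r : 'I_2 => nth s1 [:: s1; ~~ s2] r).
exists (fun i : 'I_4 => nth e [:: e; a; b; c] i); split; first exact: pair_inj.
  move=> [[|[|r]] ?] // [[|[|[|[|i]]]] ?] // [[|[|[|[|j]]]] ?] //= _;
  by rewrite ?opp_signed_coord; case: bc; lia.
move=> [[|[|r]] ?] // m i j; rewrite /= !inE => /eqP[->];
  case: i => -[|[|[|[|i]]]] // ?; case: j => -[|[|[|[|j]]]] // ? _ _ /=;
  by rewrite ?opp_signed_coord; case: bc; lia.
Qed.

Lemma embeds_132_231P : embeds sigma pattern_132_231 <-> occ_B (signed_axis sigma).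
Proof.
apply: (iff_trans (embeds_wordsP axis_perm_132_231)); split.
  move=> [h [eps [p [_ lt adj]]]].
  pose p0 := @Ordinal 3 0 isT; pose p1 := @Ordinal 3 1 isT; pose p2 := @Ordinal 3 2 isT.
  pose x := @Ordinal 3 0 isT; pose y := @Ordinal 3 1 isT; pose z := @Ordinal 3 2 isT.
  exists (signed_coord sigma (h x) (eps x)), (signed_coord sigma (h y) (eps y)).
  exists (signed_coord sigma (h z) (eps z)), (p p0), (p p1), (p p2).
  split; first by split; exact: signed_coord_axis.
  have X12 := lt x p1 p2 isT; have Y21 := lt y p2 p1 isT.
  have Z20 := lt z p2 p0 isT; have Z01 := lt z p0 p1 isT.
  have X01 := adj x (@Ordinal 2 0 isT) p0 p1; have Y02 := adj y (@Ordinal 2 0 isT) p0 p2.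
  rewrite inE in X01; rewrite inE in Y02.
  have {}X01 := X01 isT erefl erefl; have {}Y02 := Y02 isT erefl erefl.
  by split; lia.
move=> [_ [_ [_ [a [b [e [[[r1 [s1 ->]] [r2 [s2 ->]] [r3 [s3 ->]]] occ]]]]]]].
have ne12 : r1 != r2.
  by apply/eqP => E; subst r2; move: occ; rewrite /signed_coord; case: s1; case: s2 => /= -[]; lia.
have ne13 : r1 != r3.
  by apply/eqP => E; subst r3; move: occ; rewrite /signed_coord; case: s1; case: s3 => /= -[]; lia.
have ne23 : r2 != r3.
  by apply/eqP => E; subst r3; move: occ; rewrite /signed_coord; case: s2; case: s3 => /= -[]; lia.
exists (fun r : 'I_3 => nth r1 [:: r1; r2; r3] r), (fun r : 'I_3 => nth s1 [:: s1; s2; s3] r).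
exists (fun i : 'I_3 => nth e [:: a; b; e] i); split; first exact: triple_inj.
  move=> [[|[|[|r]]] ?] // [[|[|[|i]]] ?] // [[|[|[|j]]] ?] //= _;
  by case: occ; lia.
move=> [[|[|[|r]]] ?] // m i j; rewrite /= !inE // => /eqP[->];
  case: i => -[|[|[|i]]] // ?; case: j => -[|[|[|j]]] // ? _ _ /=;
  by case: occ; lia.
Qed.

(** As in 2413, the middle step of 3412 falls, so the second axis is negated. *)
Lemma embeds_3412_1432P : embeds sigma pattern_3412_1432 <-> occ_C (signed_axis sigma).
Proof.
apply: (iff_trans (embeds_wordsP axis_perm_3412_1432)); split.
  move=> [h [eps [p [_ lt adj]]]].
  pose p0 := @Ordinal 4 0 isT; pose p1 := @Ordinal 4 1 isT.
  pose p2 := @Ordinal 4 2 isT; pose p3 := @Ordinal 4 3 isT.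
  pose x := @Ordinal 3 0 isT; pose y := @Ordinal 3 1 isT; pose z := @Ordinal 3 2 isT.
  exists (signed_coord sigma (h x) (eps x)), (signed_coord sigma (h y) (~~ eps y)).
  exists (signed_coord sigma (h z) (eps z)), (p p1), (p p2), (p p0), (p p3).
  split; first by split; exact: signed_coord_axis.
  have X01 := lt x p0 p1 isT; have X23 := lt x p2 p3 isT.
  have Y23 := lt y p2 p3 isT; have Y01 := lt y p0 p1 isT.
  have Z03 := lt z p0 p3 isT; have Z32 := lt z p3 p2 isT; have Z21 := lt z p2 p1 isT.
  have X12 := adj x (@Ordinal 3 1 isT) p1 p2; have Y30 := adj y (@Ordinal 3 1 isT) p3 p0.
  rewrite inE in X12; rewrite inE in Y30.
  have {}X12 := X12 isT erefl erefl; have {}Y30 := Y30 isT erefl erefl.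
  by rewrite /crossing4 !opp_signed_coord; split; [split|]; lia.
move=> [_ [_ [_ [a [b [c [e [[[r1 [s1 ->]] [r2 [s2 ->]] [r3 [s3 ->]]] [cr occ]]]]]]]]].
have ne12 : r1 != r2.
  apply/eqP => E; subst r2; move: cr; rewrite /crossing4 /signed_coord.
  by case: s1; case: s2 => /= -[]; lia.
have ne13 : r1 != r3.
  apply/eqP => E; subst r3; move: cr occ; rewrite /crossing4 /signed_coord.
  by case: s1; case: s3 => /= -[]; lia.
have ne23 : r2 != r3.
  apply/eqP => E; subst r3; move: cr occ; rewrite /crossing4 /signed_coord.
  by case: s2; case: s3 => /= -[]; lia.
exists (fun r : 'I_3 => nth r1 [:: r1; r2; r3] r), (fun r : 'I_3 => nth s1 [:: s1; ~~ s2; s3] r).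
exists (fun i : 'I_4 => nth e [:: c; a; b; e] i); split; first exact: triple_inj.
  move=> [[|[|[|r]]] ?] // [[|[|[|[|i]]]] ?] // [[|[|[|[|j]]]] ?] //= _;
  by rewrite ?opp_signed_coord; case: cr; lia.
move=> [[|[|[|r]]] ?] // m i j; rewrite /= !inE // => /eqP[->];
  case: i => -[|[|[|[|i]]]] // ?; case: j => -[|[|[|[|j]]]] // ? _ _ /=;
  by rewrite ?opp_signed_coord; case: cr; lia.
Qed.

(** The middle step of 2143 rises, so the second axis keeps its sign. *)
Lemma embeds_2143_1423P : embeds sigma pattern_2143_1423 <-> occ_D (signed_axis sigma).
Proof.
apply: (iff_trans (embeds_wordsP axis_perm_2143_1423)); split.
  move=> [h [eps [p [_ lt adj]]]].
  pose p0 := @Ordinal 4 0 isT; pose p1 := @Ordinal 4 1 isT.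
  pose p2 := @Ordinal 4 2 isT; pose p3 := @Ordinal 4 3 isT.
  pose x := @Ordinal 3 0 isT; pose y := @Ordinal 3 1 isT; pose z := @Ordinal 3 2 isT.
  exists (signed_coord sigma (h x) (eps x)), (signed_coord sigma (h y) (eps y)).
  exists (signed_coord sigma (h z) (eps z)), (p p1), (p p2), (p p0), (p p3).
  split; first by split; exact: signed_coord_axis.
  have X01 := lt x p0 p1 isT; have X23 := lt x p2 p3 isT.
  have Y10 := lt y p1 p0 isT; have Y32 := lt y p3 p2 isT.
  have Z02 := lt z p0 p2 isT; have Z23 := lt z p2 p3 isT; have Z31 := lt z p3 p1 isT.
  have X12 := adj x (@Ordinal 3 1 isT) p1 p2; have Y03 := adj y (@Ordinal 3 1 isT) p0 p3.
  rewrite inE in X12; rewrite inE in Y03.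
  have {}X12 := X12 isT erefl erefl; have {}Y03 := Y03 isT erefl erefl.
  by rewrite /crossing4; split; [split|]; lia.
move=> [_ [_ [_ [a [b [c [e [[[r1 [s1 ->]] [r2 [s2 ->]] [r3 [s3 ->]]] [cr occ]]]]]]]]].
have ne12 : r1 != r2.
  apply/eqP => E; subst r2; move: cr; rewrite /crossing4 /signed_coord.
  by case: s1; case: s2 => /= -[]; lia.
have ne13 : r1 != r3.
  apply/eqP => E; subst r3; move: cr occ; rewrite /crossing4 /signed_coord.
  by case: s1; case: s3 => /= -[]; lia.
have ne23 : r2 != r3.
  apply/eqP => E; subst r3; move: cr occ; rewrite /crossing4 /signed_coord.
  by case: s2; case: s3 => /= -[]; lia.
exists (fun r : 'I_3 => nth r1 [:: r1; r2; r3] r), (fun r : 'I_3 => nth s1 [:: s1; s2; s3] r).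
exists (fun i : 'I_4 => nth e [:: c; a; b; e] i); split; first exact: triple_inj.
  move=> [[|[|[|r]]] ?] // [[|[|[|[|i]]]] ?] // [[|[|[|[|j]]]] ?] //= _;
  by case: cr; lia.
move=> [[|[|[|r]]] ?] // m i j; rewrite /= !inE // => /eqP[->];
  case: i => -[|[|[|[|i]]]] // ?; case: j => -[|[|[|[|j]]]] // ? _ _ /=;
  by case: cr; lia.
Qed.

End Occurrences.

(** * The symmetry class of 2413 and the equivalence *)

(** Inversion, reversal and complement each exchange 2413 and 3142, so only a parity matters. The
    reflection of [3] fixes 2, hence the adjacency sets. *)
Lemma sym_pattern_2413 (rho : {perm 'I_2}) eps :
  sym_pattern pattern_2413 rho eps =
  if (rho ord0 != ord0) (+) eps ord0 (+) eps ord_max then pattern_3142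
  else pattern_2413.
Proof.
have rev_adj : [set rev_ord j | j in adjset 4 [:: 2%N]]%SET = adjset 4 [:: 2%N].
  apply/setP => j; apply/imsetP/idP => [[m]|].
    by rewrite !inE => /eqP[m1] ->; rewrite /= m1.
  by move=> j_adj; exists j => //; apply: val_inj; move: j_adj; rewrite !inE => /eqP[/= ->].
have vadjE : vadj (sym_pattern pattern_2413 rho eps) = [tuple adjset 4 [:: 2%N]; adjset 4 [:: 2%N]].
  apply: eq_from_tnth => r; rewrite tnth_mktuple.
  have tnthE (m : 'I_2) : tnth [tuple adjset 4 [:: 2%N]; adjset 4 [:: 2%N]] m = adjset 4 [:: 2%N].
    by case: m => -[|[|m]].
  by rewrite !tnthE rev_adj if_same.
have I2 (r : 'I_2) : r = ord0 \/ r = ord_max.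
  by case: r => -[|[|r]] ? //; [left|right]; apply: val_inj.
have rho1 : rho ord_max = if rho ord0 == ord0 then ord_max else ord0.
  have : rho ord_max != rho ord0 by rewrite (inj_eq perm_inj).
  by case: (I2 (rho ord0)) => ->; case: (I2 (rho ord_max)) => ->.
have vpermE w (hw : perm_eq w (iota 1 4)) :
    (forall i, sym_axis pattern_2413 rho eps ord_max i =
       word_perm hw (sym_axis pattern_2413 rho eps ord0 i)) ->
    vperm (sym_pattern pattern_2413 rho eps) = [tuple word_perm hw].
  move=> E; apply: eq_from_tnth => r; rewrite ord1 tnth_mktuple tnth0.
  have -> : lift ord0 ord0 = ord_max :> 'I_2 by apply: val_inj.
  by apply/permP => i; rewrite permM E permKV.
move: vadjE vpermE; case: (sym_pattern pattern_2413 rho eps) => [v ad] /= -> vpermE.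
have vincularE w (hw : perm_eq w (iota 1 4)) :
    (forall i, sym_axis pattern_2413 rho eps ord_max i =
       (nth 0 w (sym_axis pattern_2413 rho eps ord0 i)).-1 :> nat)%N ->
    @Vincular 2 4 v [tuple adjset 4 [:: 2%N]; adjset 4 [:: 2%N]] =
    @Vincular 2 4 [tuple word_perm hw] [tuple adjset 4 [:: 2%N]; adjset 4 [:: 2%N]].
  by move=> E; rewrite (vpermE _ hw) // => i; apply: val_inj; rewrite permE /= E.
case: (I2 (rho ord0)) rho1 => E0; rewrite E0 /= => rho1.
all: case e0: (eps ord0); case e1: (eps ord_max) => /=.
all: apply: vincularE => i; rewrite !sym_axisE e0 e1 rho1 E0 /= !axis_perm_2413.
all: by case: i => -[|[|[|[|i]]]].
Qed.

Lemma patterns_AE : patterns_A = [set pattern_2413; pattern_3142]%classic.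
Proof.
apply/seteqP; split=> [pi /sym_classP[rho [eps ->]]|pi [->|->]].
- by rewrite sym_pattern_2413; case: ifP => _; [right|left].
- apply/sym_classP; exists 1%g, (fun=> false).
  by rewrite sym_pattern_2413 perm1 eqxx.
- apply/sym_classP; exists 1%g, (fun r => r == ord0).
  by rewrite sym_pattern_2413 perm1 eqxx.
Qed.

Theorem theorem3 (R : realType) :
  patterns_A = [set pattern_2413; pattern_3142] /\
  forall (d n : nat), (2 <= d)%N -> (1 <= n)%N ->
    forall sigma : dperm d n,
      baxter R sigma <->
      [/\ avoids sigma patterns_A, avoids sigma patterns_B,
          avoids sigma patterns_C & avoids sigma patterns_D].
Proof.
split; first exact: patterns_AE.
move=> [//|d] n _ _ sigma; apply: (iff_trans (baxterP R sigma)).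
have iff_not (P Q S : Prop) : (S <-> ~ P) -> (P <-> Q) -> (S <-> ~ Q) by tauto.
have avA := iff_not _ _ _ (avoids_sym_classP sigma _) (embeds_2413P sigma).
have avB := iff_not _ _ _ (avoids_sym_classP sigma _) (embeds_132_231P sigma).
have avC := iff_not _ _ _ (avoids_sym_classP sigma _) (embeds_3412_1432P sigma).
have avD := iff_not _ _ _ (avoids_sym_classP sigma _) (embeds_2143_1423P sigma).
split.
  move=> /crossings_agree_avoidance[nA nB nC nD].
  by split; [apply/avA|apply/avB|apply/avC|apply/avD].
move=> [/avA nA /avB nB /avC nC /avD nD].
apply: avoidance_crossings_agree => //; first exact: signed_axis_system.
exact: signed_axis_lower_bounded.
Qed.
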